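(* There are exactly $37{,}799{,}146{,}070$ transfer systems for the alternating group $A_6$; that is, $|\mathrm{Tr}(\mathrm{Sub}(A_6))| = 37799146070$.
   Context: For a finite group $G$, $\mathrm{Sub}(G)$ is the lattice of subgroups of $G$ ordered by inclusion, with $G$ acting by conjugation. A transfer system for $G$ is a partial order $\to$ on the set $\mathrm{Sub}(G)$ such that: $H\to K$ implies $H\le K$; $H\to K$ implies $gHg^{-1}\to gKg^{-1}$ for all $g\in G$; and whenever $H\to K$ and $H'\le K$, we have $H\cap H'\to H'$. $\mathrm{Tr}(\mathrm{Sub}(G))$ denotes the set of transfer systems for $G$. *)

(* Defs.v *)
From mathcomp Require Import all_boot all_fingroup all_solvable.

Set Implicit Arguments.
Unset Strict Implicit.
Unset Printing Implicit Defensive.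

Import GroupScope.

(* A relation on Sub(G) is encoded by its graph, a set of pairs of groups:    *)
(* H --> K means (H, K) \in R. Since {group gT} contains all the subgroups of *)
(* the ambient type gT, R is required to be contained in Sub(G) x Sub(G), so  *)
(* that distinct sets R are distinct relations on Sub(G).                     *)
Definition sub_porder (gT : finGroupType) (G : {group gT})
    (R : {set {group gT} * {group gT}}) : bool :=
  [&& R \subset setX (subgroups G) (subgroups G),
      [forall H in subgroups G, (H, H) \in R],
      [forall H : {group gT}, forall K : {group gT},
         ((H, K) \in R) && ((K, H) \in R) ==> (H == K)]
    & [forall H : {group gT}, forall K : {group gT}, forall L : {group gT},
         ((H, K) \in R) && ((K, L) \in R) ==> ((H, L) \in R)]].

(* As H :^ x is x^-1 H x, the group g H g^-1 is H :^ g^-1. *)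
Definition transfer_system (gT : finGroupType) (G : {group gT})
    (R : {set {group gT} * {group gT}}) : bool :=
  [&& sub_porder G R,
      [forall H : {group gT}, forall K : {group gT},
         ((H, K) \in R) ==> (H \subset K)],
      [forall g in G, forall H : {group gT}, forall K : {group gT},
         ((H, K) \in R) ==> (((H :^ g^-1)%G, (K :^ g^-1)%G) \in R)]
    & [forall H : {group gT}, forall K : {group gT}, forall H' : {group gT},
         ((H, K) \in R) && (H' \subset K) ==> (((H :&: H')%G, H') \in R)]].

Definition transfer_systems (gT : finGroupType) (G : {group gT}) :
    {set {set {group gT} * {group gT}}} :=
  [set R | transfer_system G R].

(* Main.v *)
Require Import Defs.
From HB Require Import structures.
From Stdlib Require Import BinNat PArith FMapPositive.
From mathcomp Require Import all_boot all_fingroup all_solvable.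

Set Implicit Arguments.
Unset Strict Implicit.
Unset Printing Implicit Defensive.

(** A transfer system for G is a union of G-orbits of pairs (H, K) with H <= K,
so it amounts to a set of such orbits, that is, to one truth value for each
orbit ([card_transfer_systems]).  Reflexivity, restriction and transitivity
then say that certain clauses with at most three literals hold.  For G = A_6
there are 501 subgroups in 22 conjugacy classes and 132 orbits of pairs, and
the transfer systems are exactly the models of a formula in 132 variables
([sat_transfer_cnf]).  The number of these models is computed by the classical
branching procedure for satisfiability, with unit propagation and with a
splitting of the formula into parts without common variables; [count_modelsP]
shows that the procedure counts correctly.

The formula is extracted from tables for the subgroup lattice of A_6, which
are computed and then certified by checks that are themselves evaluated.

- A subgroup is stored as a list of generators and the set of its elements.
  The set is closed under multiplication by the generators and consists of
  products of them, so it is the generated group ([row_okP]).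
- The list of subgroups is complete ([listedP]).  Given a subgroup K, take a
  listed subgroup L of K of maximal order.  If some g lies in K but not in L,
  then the group generated by L and g contains a listed subgroup that is
  strictly larger than L, which contradicts the choice of L.  Up to conjugacy
  there are only 22 groups L and 360 elements g for which this has to be
  verified, and that is what [class_roots_extendP] does.
- Orbits of pairs are found by starting from one root in each orbit and
  conjugating by two generators of A_6.  Hence two pairs with the same label
  are conjugate ([orbits_sound]); conversely a check shows that labels do not
  change under the two generators ([get_conj]).  So the labels are the orbits.
- The order of the list refines inclusion, so an intersection is the last
  listed subgroup that is contained in both groups ([meetP]). *)

(** * Counting the models of a formula in conjunctive normal form *)

HB.instance Definition _ := hasDecEq.Build positive Pos.eqb_spec.

Notation pmap := PositiveMap.t.
Notation pset := (pmap unit).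
Definition pset0 : pset := PositiveMap.empty unit.
Definition pset_add (x : positive) (S : pset) : pset := PositiveMap.add x tt S.
Definition pset_mem (x : positive) (S : pset) : bool :=
  if PositiveMap.find x S is Some _ then true else false.

Lemma pset_mem0 x : pset_mem x pset0 = false.
Proof. by rewrite /pset_mem PositiveMap.gempty. Qed.

Lemma find_add T (x y : positive) (v : T) m :
  PositiveMap.find x (PositiveMap.add y v m) =
  if x == y then Some v else PositiveMap.find x m.
Proof. by case: eqP => [->|?]; [exact: PositiveMap.gss | exact: PositiveMap.gso]. Qed.

Lemma pset_mem_add x y S : pset_mem x (pset_add y S) = (x == y) || pset_mem x S.
Proof. by rewrite /pset_mem find_add; case: eqP. Qed.

Definition literal := (bool * positive)%type.
Definition clause := seq literal.
Definition cnf := seq clause.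

(** The result [None] means that the clause has become true. *)
Fixpoint assign_clause (b : bool) (x : positive) (c : clause) : option clause :=
  match c with
  | [::] => Some [::]
  | (d, y) :: c1 =>
    if Pos.eqb x y then if Bool.eqb b d then None else assign_clause b x c1
    else if assign_clause b x c1 is Some c2 then Some ((d, y) :: c2) else None
  end.

Fixpoint assign (b : bool) (x : positive) (F : cnf) : cnf :=
  match F with
  | [::] => [::]
  | c :: F1 =>
    if assign_clause b x c is Some c1 then c1 :: assign b x F1 else assign b x F1
  end.

Inductive status := Conflict | Unit of literal | Open.

Fixpoint classify (F : cnf) (s : status) : status :=
  match F with
  | [::] => s
  | [::] :: _ => Conflict
  | [:: l] :: F1 => classify F1 (Unit l)
  | _ :: F1 => classify F1 s
  end.

Fixpoint touches (S : pset) (c : clause) : bool :=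
  if c is (_, x) :: c1 then if pset_mem x S then true else touches S c1 else false.

Fixpoint add_vars (c : clause) (S : pset) : pset :=
  if c is (_, x) :: c1 then add_vars c1 (pset_add x S) else S.

(** One pass over the clauses in [F]: those that share a variable with [S] move
to [C] and enlarge [S], the others go to [R].  The flag tells whether a clause
has moved; if none has, then [C] and [R] have no variable in common. *)
Fixpoint grow (S : pset) (C R F : cnf) (changed : bool) : pset * cnf * cnf * bool :=
  match F with
  | [::] => (S, C, R, changed)
  | c :: F1 => if touches S c then grow (add_vars c S) (c :: C) R F1 true
               else grow S C (c :: R) F1 changed
  end.

Fixpoint component (k : nat) (S : pset) (C R : cnf) : cnf * cnf :=
  match R, k with
  | [::], _ => (C, [::])
  | _, 0 => (catrev R C, [::])
  | _, k1.+1 =>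
    match grow S C [::] R false with
    | (S1, C1, R1, true) => component k1 S1 C1 R1
    | (_, C1, R1, false) => (C1, R1)
    end
  end.

(** Variables are numbered in the order in which they should be tested, so the
branching rule takes the smallest number among the leading literals. *)
Fixpoint min_var (F : cnf) (x : positive) : positive :=
  match F with
  | ((_, y) :: _) :: F1 => min_var F1 (Pos.min x y)
  | _ :: F1 => min_var F1 x
  | [::] => x
  end.

Fixpoint same_nat (a b : nat) : bool :=
  match a, b with a1.+1, b1.+1 => same_nat a1 b1 | 0, 0 => true | _, _ => false end.
(** The comparisons always succeed.  They evaluate both numbers completely, so
that under call-by-need reduction a result does not keep alive the formula that
it was computed from. *)
Definition forced (m : N) (e : nat) : option (N * nat) :=
  if N.eqb m m then if same_nat e e then Some (m, e) else None else None.

Fixpoint scale (e : nat) (m : N) : N := if e is e1.+1 then scale e1 (N.double m) else m.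
Fixpoint add_nat (a b : nat) : nat := if a is a1.+1 then add_nat a1 b.+1 else b.
(** Adds the dyadic fractions m1 / 2^e1 and m2 / 2^e2, and divides by 2^e. *)
Fixpoint align (m1 : N) (e1 : nat) (m2 : N) (e2 : nat) (e : nat) : N * nat :=
  match e1, e2 with
  | f1.+1, f2.+1 => align m1 f1 m2 f2 e.+1
  | 0, _ => (N.add (scale e2 m1) m2, add_nat e2 e)
  | _, 0 => (N.add m1 (scale e1 m2), add_nat e1 e)
  end.

(** A result [(m, e)] means that the fraction m / 2^e of all assignments
satisfies [F].  Fractions do not depend on the set of variables under
consideration: they multiply over independent parts of the formula, are
averaged over the two values of a variable and are halved by a unit clause. *)
Fixpoint count_models (k : nat) (F : cnf) : option (N * nat) :=
  if k isn't k1.+1 then None else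
  match classify F Open with
  | Conflict => Some (N0, 0)
  | Unit (b, x) =>
    if count_models k1 (assign b x F) is Some (m, e) then Some (m, e.+1) else None
  | Open =>
    match F with
    | [::] => Some (Npos 1, 0)
    | [::] :: _ => None
    | (((_, y) :: _) as c) :: F1 =>
      let: (C, R) := component k1 (add_vars c pset0) [:: c] F1 in
      let x := min_var C y in
      if count_models k1 (assign true x C) isn't Some (m1, e1) then None else
      if count_models k1 (assign false x C) isn't Some (m2, e2) then None else
      let: (m, e) := align m1 e1 m2 e2 1 in
      if forced m e isn't Some (m3, e3) then None else
      if R is [::] then Some (m3, e3) else
      if count_models k1 R isn't Some (m4, e4) then None else
      forced (N.mul m3 m4) (add_nat e3 e4)
    end
  end.

Section Semantics.
Variable n : nat.
Implicit Types (f g : {ffun 'I_n -> bool}) (F : cnf) (c : clause).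

(** Variables are numbered from 1, ordinals from 0. *)
Definition value f (x : positive) : bool := oapp f false (insub (Pos.to_nat x).-1).
Definition holds f c := has (fun l : literal => value f l.2 == l.1) c.
Definition sat f F := all (holds f) F.
Definition vars F : seq positive := [seq l.2 | l <- flatten F].

Lemma vars_cons c F : vars (c :: F) = [seq l.2 | l <- c] ++ vars F.
Proof. by rewrite /vars /= map_cat. Qed.

Lemma vars_cat F G : vars (F ++ G) = vars F ++ vars G.
Proof. by rewrite /vars flatten_cat map_cat. Qed.

Lemma sat_cat f F G : sat f (F ++ G) = sat f F && sat f G.
Proof. exact: all_cat. Qed.

Lemma holds_ext f g c : {in [seq l.2 | l <- c], value f =1 value g} -> holds f c = holds g c.
Proof.
move=> efg; apply: eq_in_has => l lc.
by rewrite efg // map_f.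
Qed.

Lemma sat_ext f g F : {in vars F, value f =1 value g} -> sat f F = sat g F.
Proof.
elim: F => // c F IH; rewrite vars_cons => efg /=.
rewrite (IH (sub_in1 _ efg)) ?(holds_ext (sub_in1 _ efg)) // => x xF;
  by rewrite mem_cat xF ?orbT.
Qed.

Lemma assign_clauseP f b x c : value f x = b ->
  (if assign_clause b x c is Some c1 then holds f c1 else true) = holds f c.
Proof.
move=> fx; elim: c => //= -[d y] c; rewrite /= -/(x == y).
case: eqP => [<-|_].
  by rewrite fx; case: b d {fx} => -[].
case: (assign_clause b x c) => [c1|] /= IH; last by rewrite -IH orbT.
by rewrite IH.
Qed.

Lemma assignP f b x F : value f x = b -> sat f (assign b x F) = sat f F.
Proof.
move=> fx; elim: F => //= c F IH.
by rewrite -(assign_clauseP c fx); case: (assign_clause b x c) => //= c1; rewrite IH.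
Qed.

Lemma assign_clause_vars b x c c1 y : assign_clause b x c = Some c1 ->
  y \in [seq l.2 | l <- c1] -> (y != x) && (y \in [seq l.2 | l <- c]).
Proof.
elim: c c1 => [|[d z] c IH] c1 /=; first by case=> <-.
rewrite -/(x == z) inE; case: eqP => [_|/eqP nxz].
  by case: ifP => // _ /IH H /H /andP[-> ->]; rewrite orbT.
case: (assign_clause b x c) IH => // c2 IH [<-] /=; rewrite inE.
by case/orP=> [/eqP->|/(IH _ erefl)/andP[-> ->]]; rewrite ?eqxx ?orbT // eq_sym nxz.
Qed.

Lemma assign_vars b x F y : y \in vars (assign b x F) -> (y != x) && (y \in vars F).
Proof.
elim: F => //= c F IH; rewrite vars_cons mem_cat.
case E: (assign_clause b x c) => [c1|]; last by move/IH/andP=> [-> ->]; rewrite orbT.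
rewrite vars_cons mem_cat => /orP[/(assign_clause_vars E)|/IH] /andP[-> ->] //.
by rewrite orbT.
Qed.

Definition nsat F := #|[set f | sat f F]|.
Definition in_range (x : positive) := Pos.to_nat x <= n.
Definition flip (x : positive) f : {ffun 'I_n -> bool} :=
  [ffun i : 'I_n => if i == (Pos.to_nat x).-1 :> nat then ~~ f i else f i].

Lemma flipK x : involutive (flip x).
Proof. by move=> f; apply/ffunP=> i; rewrite !ffunE; case: eqP; rewrite ?negbK. Qed.

Lemma to_nat_inj (x y : positive) : (Pos.to_nat x).-1 = (Pos.to_nat y).-1 -> x = y.
Proof.
have := Pos2Nat.is_pos x; have := Pos2Nat.is_pos y => /ltP hy /ltP hx /(congr1 S).
by rewrite !prednK // => /Pos2Nat.inj.
Qed.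

Lemma in_rangeP x : in_range x ->
  {i : 'I_n | insub (Pos.to_nat x).-1 = Some i & i = (Pos.to_nat x).-1 :> nat}.
Proof.
move=> xn; have lt_x : (Pos.to_nat x).-1 < n.
  by rewrite prednK //; apply/ltP; exact: Pos2Nat.is_pos.
by exists (Ordinal lt_x) => //; rewrite insubT.
Qed.

Lemma value_flip x f y : in_range x ->
  value (flip x f) y = if y == x then ~~ value f y else value f y.
Proof.
move=> xn; rewrite /value; case: insubP => [i _ iE|] /=.
  rewrite ffunE iE; case: (y =P x) => [->|nyx]; first by rewrite eqxx.
  by case: eqP => // /to_nat_inj.
by case: eqP => // ->; have [i _ <-] := in_rangeP xn; rewrite ltn_ord.
Qed.

(** After the assignment [x] no longer occurs, so flipping its value pairs the
models in which [x] has value [b] with the other ones. *)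
Lemma nsat_assign b x F : in_range x ->
  nsat (assign b x F) = 2 * #|[set f | (value f x == b) && sat f F]|.
Proof.
move=> xn; set A := [set f | _ && _]; rewrite mul2n -addnn.
have -> : nsat (assign b x F) = #|A :|: flip x @: A|; last first.
  rewrite cardsU (card_imset _ (inv_inj (flipK x))) disjoint_setI0 ?cards0 ?subn0 //.
  rewrite disjoints_subset; apply/subsetP=> f; rewrite !inE => /andP[/eqP fx _].
  apply/imsetP=> -[g]; rewrite inE => /andP[/eqP gx _] fE.
  by move: fx; rewrite fE value_flip // eqxx gx; case: (b).
have sat_flip f : sat (flip x f) (assign b x F) = sat f (assign b x F).
  apply: sat_ext => y /assign_vars/andP[yx _]; rewrite value_flip //.
  by rewrite (negPf yx).
apply: eq_card => f; rewrite !inE.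
have [fx|fx] := eqVneq (value f x) b.
  rewrite assignP // /=; case: (sat f F) => //=; apply/esym/imsetP => -[g].
  rewrite inE => /andP[/eqP gx _] fE.
  by move: fx; rewrite fE value_flip // eqxx gx; case: (b).
rewrite /=; apply/idP/imsetP => [sf|[g]].
  exists (flip x f); rewrite ?flipK // inE value_flip // eqxx.
  have -> : ~~ value f x == b by case: (value f x) (b) fx => -[].
  have fxb : value (flip x f) x = b by rewrite value_flip // eqxx; case: (value f x) (b) fx => -[].
  by rewrite -(assignP _ fxb) sat_flip.
by rewrite inE => /andP[/eqP gx sg] ->; rewrite sat_flip assignP.
Qed.

Lemma nsat_split x F : in_range x ->
  nsat (assign true x F) + nsat (assign false x F) = 2 * nsat F.
Proof.
move=> xn; rewrite !nsat_assign // -mulnDr; congr (2 * _).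
rewrite -cardsUI [X in _ + X](_ : _ = 0) ?addn0.
  by apply: eq_card => f; rewrite !inE; case: (value f x); rewrite ?orbF.
apply/eqP; rewrite cards_eq0; apply/eqP/setP=> f; rewrite !inE.
by case: (value f x); rewrite ?andbF.
Qed.

Lemma nsat_unit b x F : in_range x -> [:: (b, x)] \in F -> nsat (assign b x F) = 2 * nsat F.
Proof.
move=> xn uF; rewrite nsat_assign //; congr (2 * _).
apply: eq_card => f; rewrite !inE andbC; case sF: (sat f F) => //=.
by have /allP/(_ _ uF) := sF; rewrite /holds /= orbF.
Qed.

Lemma nsat_nil : nsat [::] = 2 ^ n.
Proof.
have -> : nsat [::] = #|{: {ffun 'I_n -> bool}}|.
  by rewrite /nsat -cardsT; apply: eq_card => f; rewrite !inE.
by rewrite card_ffun card_bool card_ord.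
Qed.

Lemma nsat_conflict F : [::] \in F -> nsat F = 0.
Proof.
move=> nF; apply/eqP; rewrite cards_eq0; apply/eqP/setP=> f; rewrite !inE.
by apply/negP=> /allP/(_ _ nF).
Qed.

Lemma nsat_perm F G : perm_eq F G -> nsat F = nsat G.
Proof. by move=> e; apply: eq_card => f; rewrite !inE; exact: perm_all. Qed.

Definition mix F f g : {ffun 'I_n -> bool} :=
  [ffun i : 'I_n => if has (fun x => i == (Pos.to_nat x).-1 :> nat) (vars F) then f i else g i].

Lemma value_mix F f g x : value (mix F f g) x = if x \in vars F then value f x else value g x.
Proof.
rewrite /value; case: insubP => [i _ iE|] /=; last by case: ifP.
rewrite ffunE iE -has_pred1; congr (if _ then _ else _); apply: eq_has => y /=.
by rewrite [RHS]eq_sym; apply/eqP/eqP => [/to_nat_inj //|->].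
Qed.

(** Exchanging the values at the variables of [F] is an involution on pairs of
assignments.  It maps the pairs whose first component satisfies both formulas
to the pairs that satisfy [F] and [G] respectively. *)
Lemma nsat_cat F G : {in vars F, forall x, x \notin vars G} ->
  nsat (F ++ G) * 2 ^ n = nsat F * nsat G.
Proof.
move=> dFG; rewrite -nsat_nil.
pose sw (p : {ffun 'I_n -> bool} * {ffun 'I_n -> bool}) := (mix F p.1 p.2, mix F p.2 p.1).
have swK : involutive sw.
  by case=> f g; rewrite /sw; congr pair; apply/ffunP=> i; rewrite /= !ffunE; case: (has _ _).
have -> : nsat (F ++ G) * nsat [::] = #|setX [set f | sat f (F ++ G)] [set f | sat f [::]]|.
  by rewrite cardsX.
have -> : nsat F * nsat G = #|setX [set f | sat f F] [set f | sat f G]| by rewrite cardsX.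
rewrite -(card_imset _ (inv_inj swK)); apply: eq_card => -[f g].
rewrite -[(f, g)]swK mem_imset; last exact: inv_inj swK.
rewrite swK !inE /= andbT sat_cat /sw /=; congr (_ && _); apply: sat_ext => x xv; rewrite value_mix.
  by rewrite xv.
by case: ifP => // /dFG; rewrite xv.
Qed.

Lemma touchesP S c : touches S c = has (fun x => pset_mem x S) [seq l.2 | l <- c].
Proof. by elim: c => //= -[d x] c ->; case: pset_mem. Qed.

Lemma add_varsP S c x : pset_mem x (add_vars c S) = (x \in [seq l.2 | l <- c]) || pset_mem x S.
Proof.
elim: c S => //= -[d y] c IH S /=; rewrite IH pset_mem_add inE /=.
by rewrite orbA [in RHS](orbC (x == y)).
Qed.

Definition covered S C := {in vars C, forall x, pset_mem x S}.
Definition avoids S R := {in vars R, forall x, ~~ pset_mem x S}.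

Lemma growP S C R F b S1 C1 R1 b1 :
  grow S C R F b = (S1, C1, R1, b1) -> covered S C ->
  [/\ perm_eq (C1 ++ R1) (C ++ R ++ F), covered S1 C1, b -> b1
    & ~~ b1 -> avoids S R -> [/\ S1 = S & avoids S R1]].
Proof.
elim: F S C R b => [|c F IH] S C R b /=.
  by case=> <- <- <- <- cC; split=> //; rewrite cats0.
case: ifP => [tc|/negbT tc] /IH H cC; case: H => //.
- move=> x; rewrite vars_cons mem_cat add_varsP => /orP[->//|/cC->]; exact: orbT.
- move=> p1 c1 b1T h1; rewrite b1T //; split=> //.
    apply/seq.permP=> a; move/seq.permP/(_ a): p1; rewrite !count_cat /= => ->.
    by rewrite -!addnA addnCA [in RHS](addnCA (count a R)).
- move=> p1 c1 bb1 h1; split=> //.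
    apply/seq.permP=> a; move/seq.permP/(_ a): p1; rewrite !count_cat /= => ->.
    by rewrite -!addnA (addnCA (count a R)).
  move=> b1F aR; apply: h1 => // x; rewrite vars_cons mem_cat => /orP[xc|/aR//].
  by apply: contra tc => xS; rewrite touchesP; apply/hasP; exists x.
Qed.

Arguments grow : simpl never.
Lemma componentP k S C R C1 R1 : component k S C R = (C1, R1) -> covered S C ->
  perm_eq (C1 ++ R1) (C ++ R) /\ {in vars C1, forall x, x \notin vars R1}.
Proof.
elim: k S C R => [|k IH] S C [|r R] /=; try by case=> <- <-; split.
  case=> <- <- cC; split=> //; rewrite cats0 catrevE -cat_rcons -rev_cons perm_catC.
  by rewrite perm_cat2l perm_rev.
case E: (grow _ _ _ (r :: R) _) => [[[S2 C2] R2] []].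
  move=> /IH H cC; have [p2 c2 _ _] := growP E cC.
  by have [p1 d1] := H c2; split=> //; rewrite (perm_trans p1).
case=> <- <- cC; have [p2 c2 _ h2] := growP E cC.
have [|eS aR] := h2 isT => //; split=> // x xC.
by apply/negP=> /aR; rewrite -eS (c2 _ xC).
Qed.

Definition bounded F := {in vars F, forall x, in_range x}.
Definition counts F (m : N) (e : nat) := nsat F * 2 ^ e = m * 2 ^ n.
End Semantics.

Lemma nat_of_add_bin (a b : N) : N.add a b = a + b :> nat.
Proof. by case: a b => [|p] [|q] //=; rewrite ?addn0 ?nat_of_add_pos. Qed.

Lemma nat_of_mul_bin (a b : N) : N.mul a b = a * b :> nat.
Proof. by case: a b => [|p] [|q] //=; rewrite ?muln0 ?nat_of_mul_pos. Qed.

Lemma nat_of_double_bin (m : N) : N.double m = m.*2 :> nat.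
Proof. by case: m => //= p; rewrite NatTrec.doubleE. Qed.

Lemma scaleE e m : scale e m = m * 2 ^ e :> nat.
Proof.
elim: e m => [|e IH] m /=; first by rewrite muln1.
by rewrite IH nat_of_double_bin expnS mulnA muln2.
Qed.

Lemma add_natE a b : add_nat a b = a + b.
Proof. by elim: a b => //= a IH b; rewrite IH addnS. Qed.

Lemma alignP m1 e1 m2 e2 e m f : align m1 e1 m2 e2 e = (m, f) ->
  exists d1 d2, [/\ e1 + d1 = e2 + d2, f = e + (e1 + d1)
                  & m = m1 * 2 ^ d1 + m2 * 2 ^ d2 :> nat].
Proof.
elim: e1 e2 e => [|e1 IH] [|e2] e /=.
- by case=> <- <-; exists 0, 0; rewrite !expn0 !muln1 nat_of_add_bin !addn0.
- rewrite -/(scale e2.+1 m1) => -[<- <-]; exists e2.+1, 0.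
  rewrite nat_of_add_bin /= scaleE nat_of_double_bin -muln2 -mulnA -expnS.
  by rewrite expn0 muln1 add_natE add0n !addn0 !addnS addnC.
- rewrite -/(scale e1.+1 m2) => -[<- <-]; exists 0, e1.+1.
  rewrite nat_of_add_bin /= scaleE nat_of_double_bin -muln2 -mulnA -expnS.
  by rewrite expn0 muln1 add_natE add0n !addn0 !addnS addnC.
by case/IH=> d1 [d2 [eq12 -> mE]]; exists d1, d2; rewrite !addSn eq12 addnS.
Qed.

Lemma forcedP m e m1 e1 : forced m e = Some (m1, e1) -> m1 = m /\ e1 = e.
Proof. by rewrite /forced; do 2!case: ifP => // _; case=> -> ->. Qed.

Lemma classifyP F s :
  match classify F s with
  | Conflict => [::] \in F \/ s = Conflict
  | Unit l => [:: l] \in F \/ s = Unit l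
  | Open => [::] \notin F
  end.
Proof.
elim: F s => [|[|l [|l1 c]] F IH] s /=; first by case: s => *; [right|right|].
- by left; rewrite mem_head.
- have := IH (Unit l); case: classify => [[nF|//]|m [mF|[<-]]|nF];
    rewrite inE ?nF ?mF ?eqxx ?orbT //; by left.
have := IH s; case: classify => [[nF|->]|m [mF|->]|nF];
  rewrite inE ?nF ?mF ?orbT //; by [left | right].
Qed.

Lemma min_var_mem F x : min_var F x = x \/ min_var F x \in vars F.
Proof.
elim: F x => [|[|[d y] c] F IH] x /=; first by left.
  by rewrite vars_cons.
rewrite vars_cons /= inE mem_cat; case: (IH (Pos.min x y)) => [->|->]; last first.
  by right; rewrite !orbT.
by case: (Pos.min_spec x y) => -[_ ->]; [left | right; rewrite eqxx].
Qed.

(** Multiplying by the powers of 2 expresses the equality of fractions within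
the natural numbers. *)
Theorem count_modelsP n k F m e : count_models k F = Some (m, e) -> bounded n F -> counts n F m e.
Proof.
rewrite /counts; elim: k F m e => //= k IH F m e.
have := classifyP F Open; case: classify => [[nF|//]|[b x] [uF|//]|nF].
- by case=> <- <- _; rewrite nsat_conflict // !mul0n.
- case E: (count_models k _) => [[m1 e1]|//] [<- <-] bF.
  have xn : in_range n x.
    apply: bF; apply/mapP; exists (b, x) => //; apply/flattenP.
    by exists [:: (b, x)]; rewrite ?mem_head.
  rewrite expnS mulnA [_ * 2]mulnC -(nsat_unit xn uF); apply: IH E _ => y.
  by case/assign_vars/andP=> _ /bF.
case: F nF => [_ [<- <-] _|]; first by rewrite nsat_nil muln1 mul1n.
case=> [//|[d y] c] F nF; set c0 := (d, y) :: c.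
case E: (component _ _ _ _) => [C R].
case E1: (count_models k _) => [[m1 e1]|//].
case E2: (count_models k _) => [[m2 e2]|//].
case E3: align => [m0 e0]; case E4: (forced _ _) => [[m3 e3]|//] H bF.
have [m3E e3E] := forcedP E4.
have [|pCR dCR] := componentP E.
  by move=> x; rewrite vars_cons cats0 add_varsP => ->.
have eqv x : (x \in vars (c0 :: F)) = (x \in vars C) || (x \in vars R).
  rewrite -mem_cat -vars_cat /vars; apply: perm_mem; apply: perm_map.
  rewrite perm_sym; exact: perm_flatten.
have bC : bounded n C by move=> x xC; apply: bF; rewrite eqv xC.
have bR : bounded n R by move=> x xR; apply: bF; rewrite eqv xR orbT.
have countC : nsat n C * 2 ^ e3 = m3 * 2 ^ n.
  have xn : in_range n (min_var C y).
    case: (min_var_mem C y) => [->|/bC//]; apply: bF; rewrite vars_cons; exact: mem_head.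
  have {}E1 := IH _ _ _ E1; have {}E2 := IH _ _ _ E2.
  have [d1 [d2 [eq12 e0E m0E]]] := alignP E3.
  rewrite e3E e0E m3E m0E expnD expn1 mulnA [_ * 2]mulnC -(nsat_split C xn).
  rewrite mulnDl {2}eq12 !expnD !mulnA E1 ?E2 ?mulnDl; first by congr (_ + _); rewrite mulnAC.
    by move=> z /assign_vars/andP[_ /bC].
  by move=> z /assign_vars/andP[_ /bC].
rewrite -(nsat_perm n pCR); case: R H {E eqv} dCR bR {pCR} => [|r R].
  by case=> <- <- _ _; rewrite cats0.
case E5: (count_models k _) => [[m4 e4]|//] /forcedP[-> ->] dCR bR.
apply/eqP; rewrite -(eqn_pmul2r (expn_gt0 2 n)) //.
rewrite nat_of_mul_bin add_natE expnD mulnAC nsat_cat // mulnACA countC.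
by rewrite (IH _ _ _ E5) // mulnACA -!mulnA.
Qed.

(** * Permutations of six points as data *)

Inductive point := p0 | p1 | p2 | p3 | p4 | p5.
Inductive perm6 := P6 of point & point & point & point & point & point.

Definition ap (s : perm6) (x : point) : point :=
  let: P6 a b c d e f := s in
  match x with p0 => a | p1 => b | p2 => c | p3 => d | p4 => e | p5 => f end.
Definition mul (s t : perm6) : perm6 :=
  let: P6 a b c d e f := s in P6 (ap t a) (ap t b) (ap t c) (ap t d) (ap t e) (ap t f).
Definition one := P6 p0 p1 p2 p3 p4 p5.
Definition word (s : perm6) : seq point := let: P6 a b c d e f := s in [:: a; b; c; d; e; f].
Definition unword (w : seq point) : perm6 :=
  if w is [:: a; b; c; d; e; f] then P6 a b c d e f else one.
Lemma wordK : cancel word unword. Proof. by case. Qed.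

Definition ord_of (x : point) : 'I_6 :=
  match x with
  | p0 => @Ordinal 6 0 isT | p1 => @Ordinal 6 1 isT | p2 => @Ordinal 6 2 isT
  | p3 => @Ordinal 6 3 isT | p4 => @Ordinal 6 4 isT | p5 => @Ordinal 6 5 isT
  end.
Definition pt_of (i : 'I_6) : point := nth p0 [:: p0; p1; p2; p3; p4; p5] i.
Lemma ord_ofK : cancel ord_of pt_of. Proof. by case. Qed.

Lemma pt_ofK : cancel pt_of ord_of.
Proof. by case=> -[|[|[|[|[|[|//]]]]]] lti; apply: val_inj. Qed.

Definition point_eqb (x y : point) : bool :=
  match x, y with
  | p0, p0 | p1, p1 | p2, p2 | p3, p3 | p4, p4 | p5, p5 => true
  | _, _ => false
  end.
Lemma point_eqP : Equality.axiom point_eqb.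
Proof. by case=> -[]; constructor. Qed.

HB.instance Definition _ := hasDecEq.Build point point_eqP.

Definition perm6_eqb (s t : perm6) : bool :=
  let: P6 a b c d e f := s in let: P6 a1 b1 c1 d1 e1 f1 := t in
  [&& point_eqb a a1, point_eqb b b1, point_eqb c c1, point_eqb d d1,
      point_eqb e e1 & point_eqb f f1].
Lemma perm6_eqP : Equality.axiom perm6_eqb.
Proof.
case=> a b c d e f [a1 b1 c1 d1 e1 f1] /=; apply: (iffP idP) => [|[<- <- <- <- <- <-]].
  by do 5![case/andP=> /point_eqP->]; move/point_eqP->.
by rewrite -!/(_ == _) !eqxx.
Qed.

HB.instance Definition _ := hasDecEq.Build perm6 perm6_eqP.

(** Sets of words over the six points, as trees in which a word is a path.  They
store sets of permutations with cheap membership and insertion. *)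
Inductive trie := Empty | Leaf | Node of trie & trie & trie & trie & trie & trie.
Definition child (t : trie) (x : point) : trie :=
  if t is Node a b c d e f then
    match x with p0 => a | p1 => b | p2 => c | p3 => d | p4 => e | p5 => f end
  else Empty.
Definition set_child (t : trie) (x : point) (u : trie) : trie :=
  match t with
  | Node a b c d e f =>
    match x with
    | p0 => Node u b c d e f | p1 => Node a u c d e f | p2 => Node a b u d e f
    | p3 => Node a b c u e f | p4 => Node a b c d u f | p5 => Node a b c d e u
    end
  | _ =>
    match x with
    | p0 => Node u Empty Empty Empty Empty Empty
    | p1 => Node Empty u Empty Empty Empty Empty
    | p2 => Node Empty Empty u Empty Empty Empty
    | p3 => Node Empty Empty Empty u Empty Empty
    | p4 => Node Empty Empty Empty Empty u Empty
    | p5 => Node Empty Empty Empty Empty Empty u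
    end
  end.
Fixpoint has_word (t : trie) (w : seq point) : bool :=
  match w with
  | [::] => if t is Leaf then true else false
  | x :: w1 => if t is Empty then false else has_word (child t x) w1
  end.
Fixpoint add_word (w : seq point) (t : trie) : trie :=
  if w is x :: w1 then set_child t x (add_word w1 (child t x)) else Leaf.
Fixpoint words (prefix : seq point) (t : trie) : seq (seq point) :=
  match t with
  | Empty => [::]
  | Leaf => [:: rev prefix]
  | Node a b c d e f =>
    words (p0 :: prefix) a ++ words (p1 :: prefix) b ++ words (p2 :: prefix) c ++
    words (p3 :: prefix) d ++ words (p4 :: prefix) e ++ words (p5 :: prefix) f
  end.
Definition mem_trie (t : trie) (s : perm6) : bool := has_word t (word s).
Definition add_trie (s : perm6) (t : trie) : trie := add_word (word s) t.
Definition elements (t : trie) : seq perm6 := [seq unword w | w <- words [::] t].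

Lemma has_word_Empty w : has_word Empty w = false.
Proof. by case: w. Qed.

Lemma has_add_word w t u : has_word (add_word w t) u -> u = w \/ has_word t u.
Proof.
elim: w t u => [|x w IH] t [|y u] /=; rewrite ?has_word_Empty; try by left.
  by case: t => [||a b c d e f]; case: x.
have hE : has_word (child t y) u -> has_word t (y :: u).
  by case: t => //=; rewrite has_word_Empty.
case: (x =P y) => [->|nxy] H.
  have [|->|/hE] := IH (child t y) u; [|by left|by right].
  by case: t H {IH hE} => [||a b c d e f]; case: y.
right; apply: hE; case: t H {IH} => [||a b c d e f]; case: x nxy; case: y => //= nxy;
  rewrite ?has_word_Empty //; by case: nxy.
Qed.

Lemma mem_add s t u : mem_trie (add_trie s t) u -> u = s \/ mem_trie t u.
Proof. by case/has_add_word=> [/(can_inj wordK)->|]; [left | right]. Qed.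

Lemma mem_words prefix t w : has_word t w -> rev prefix ++ w \in words prefix t.
Proof.
elim: t prefix w => [|| a IHa b IHb c IHc d IHd e IHe f IHf] prefix [|x w] //=.
- by rewrite cats0 mem_head.
- by rewrite has_word_Empty.
rewrite -cat_rcons -rev_cons !mem_cat.
by case: x => /= [/IHa|/IHb|/IHc|/IHd|/IHe|/IHf] ->; rewrite ?orbT.
Qed.

Lemma mem_elements t s : mem_trie t s -> s \in elements t.
Proof. by move/(mem_words [::])=> /(map_f unword); rewrite wordK. Qed.

Import GroupScope.

(** Permutations act on the right, so the code of a product composes from left
to right, as [mul] does. *)
Definition code (s : 'S_6) : perm6 :=
  let x i := pt_of (s (ord_of i)) in P6 (x p0) (x p1) (x p2) (x p3) (x p4) (x p5).

Lemma ap_code s x : ap (code s) x = pt_of (s (ord_of x)).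
Proof. by case: x. Qed.

Lemma code_inj : injective code.
Proof.
move=> s t est; apply/permP=> i; apply: (can_inj pt_ofK).
by rewrite -[i]pt_ofK -!ap_code est.
Qed.

Lemma codeM s t : code (s * t) = mul (code s) (code t).
Proof. by congr P6; rewrite ap_code pt_ofK permM. Qed.

Lemma code1 : code 1 = one.
Proof. by congr P6; rewrite perm1 ord_ofK. Qed.

Definition is_perm (p : perm6) : bool := uniq (word p).

Lemma is_permP p : is_perm p -> exists s, code s = p.
Proof.
move=> up; pose f i := ord_of (ap p (pt_of i)).
have apE x : ap p x = nth p0 (word p) (ord_of x) by case: p {up f} => *; case: x.
have inj_f : injective f.
  move=> i j /(can_inj ord_ofK) /eqP; rewrite !apE nth_uniq ?pt_ofK //; first by move/eqP/val_inj.
    by case: (p).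
  by case: (p).
exists (perm inj_f); case: p {up apE} @f inj_f => a b c d e g f inj_f.
by congr P6; rewrite permE /f ord_ofK.
Qed.

(** * Subgroups given by generators *)

Definition visit (x : perm6) (st : trie * seq perm6) (g : perm6) : trie * seq perm6 :=
  let: (T, todo) := st in
  let y := mul x g in if mem_trie T y then st else (add_trie y T, y :: todo).
(** Closes [todo] under right multiplication by [gens].  The search stops with
[None] as soon as it meets an element of [good]. *)
Fixpoint explore (k : nat) (gens : seq perm6) (good T : trie) (todo : seq perm6) :
    option trie :=
  match k, todo with
  | k1.+1, x :: todo1 =>
    if mem_trie good x then None else
    let: (T1, todo2) := foldl (visit x) (T, todo1) gens in explore k1 gens good T1 todo2
  | _, _ => Some T
  end.
(** The bound 400 exceeds the order 360 of the largest group that occurs. *)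
Definition span_trie (gens : seq perm6) : trie :=
  if explore 400 gens Empty (add_trie one Empty) [:: one] is Some T then T else Empty.

Definition in_code (K : {set 'S_6}) (p : perm6) := exists2 s, s \in K & code s = p.

Lemma in_codeM (K : {group 'S_6}) p q : in_code K p -> in_code K q -> in_code K (mul p q).
Proof. by case=> s sK <- [t tK <-]; exists (s * t); rewrite ?groupM // codeM. Qed.

Lemma exploreP (K : {group 'S_6}) k gens good T todo :
  (forall g, g \in gens -> in_code K g) -> (forall x, x \in todo -> in_code K x) ->
  (forall p, mem_trie T p -> in_code K p) ->
  if explore k gens good T todo is Some T1 then forall p, mem_trie T1 p -> in_code K p
  else exists2 x, mem_trie good x & in_code K x.
Proof.
move=> Kgens; elim: k T todo => [|k IH] T [|x todo] //= Ktodo KT.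
case: ifP => [gx|_]; first by exists x => //; apply: Ktodo; exact: mem_head.
have Kx : in_code K x by apply: Ktodo; exact: mem_head.
have {}Ktodo y : y \in todo -> in_code K y by move=> yt; apply: Ktodo; rewrite inE yt orbT.
suff: let st := foldl (visit x) (T, todo) gens in
    (forall y, y \in st.2 -> in_code K y) /\ (forall p, mem_trie st.1 p -> in_code K p).
  by case: foldl => T1 todo1 [/= ? ?]; apply: IH.
elim: gens Kgens T todo KT Ktodo {IH} => //= g gens IH Kgens T todo KT Ktodo.
have Kxg : in_code K (mul x g) by apply: in_codeM => //; apply: Kgens; exact: mem_head.
have {}Kgens h : h \in gens -> in_code K h by move=> hg; apply: Kgens; rewrite inE hg orbT.
case: ifP => _; apply: IH => //.
  by move=> p /mem_add[->|/KT].
by move=> y; rewrite inE => /orP[/eqP->|/Ktodo].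
Qed.

(** Generators of a subgroup, together with its elements. *)
Definition row := (seq perm6 * trie)%type.
Definition row_ok (r : row) : bool :=
  let: (gens, T) := r in
  let C := span_trie gens in
  [&& all is_perm gens, mem_trie T one,
      all (fun x => all (fun g => mem_trie T (mul x g)) gens) (elements T)
    & all (mem_trie C) (elements T)].
Definition below (r q : row) : bool := all (mem_trie q.2) r.1.

Definition group_of (gens : seq perm6) : {group 'S_6} := <<[set s | code s \in gens]>>%G.

Lemma in_group_of gens g : all is_perm gens -> g \in gens -> in_code (group_of gens) g.
Proof.
move=> /allP pg gg; have [s sg] := is_permP (pg g gg).
by exists s => //; apply: mem_gen; rewrite inE sg.
Qed.

Lemma mem_span_trie gens p :
  all is_perm gens -> mem_trie (span_trie gens) p -> in_code (group_of gens) p.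
Proof.
move=> pg; rewrite /span_trie.
have K1 : in_code (group_of gens) one by exists 1; rewrite ?group1 ?code1.
have: forall g, g \in gens -> in_code (group_of gens) g by move=> g; exact: in_group_of.
move/(@exploreP (group_of gens) 400 gens Empty (add_trie one Empty) [:: one]).
case: explore => [T|] H; last by rewrite /= /mem_trie has_word_Empty.
apply: H => [x|q]; first by rewrite inE => /eqP->.
by case/mem_add=> [->|]; rewrite // /mem_trie has_word_Empty.
Qed.

(** The elements found by the search are products of generators.  Conversely the
elements that send the stored set into itself by right multiplication form a
group that contains the generators, and the stored set contains 1. *)
Lemma row_okP r : row_ok r -> forall s, mem_trie r.2 (code s) = (s \in group_of r.1).
Proof.
case: r => gens T /= /and4P[pg T1 /allP TM /allP TC] s.
apply/idP/idP => [Ts|sG].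
  have [t tG /code_inj<-] := mem_span_trie pg (TC _ (mem_elements Ts)); exact: tG.
pose A := [set s | mem_trie T (code s)].
pose St := [set t | A :* t \subset A].
have gSt : group_set St.
  apply/group_setP; split=> [|t u]; first by rewrite inE rcoset1.
  by rewrite !inE rcosetM => At Au; apply: subset_trans Au; rewrite mulSg.
have: group_of gens \subset Group gSt.
  rewrite gen_subG; apply/subsetP=> t; rewrite !inE => tg.
  apply/subsetP=> _ /rcosetP[a aA ->]; rewrite !inE in aA *.
  by rewrite codeM; have /allP := TM _ (mem_elements aA); apply.
move/subsetP/(_ s sG); rewrite inE => /subsetP/(_ s).
by rewrite !inE => -> //; apply/rcosetP; exists 1; rewrite ?mul1g // inE code1.
Qed.

Lemma belowP r q : row_ok r -> row_ok q -> below r q = (group_of r.1 \subset group_of q.1).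
Proof.
move=> okr okq; rewrite gen_subG; apply/allP/subsetP => [H s | H g gr].
  by rewrite inE -(row_okP okq) => /H.
have /is_permP[s sg] : is_perm g by case: r okr gr {H} => gens T /= /and4P[/allP pg _ _ _] /pg.
by rewrite -sg (row_okP okq); apply: H; rewrite inE sg.
Qed.

Definition decode (p : perm6) : 'S_6 := odflt 1 [pick s | code s == p].
Lemma decodeK p : is_perm p -> code (decode p) = p.
Proof.
case/is_permP=> s sp; rewrite /decode; case: pickP => [t /eqP//|/(_ s)].
by rewrite sp eqxx.
Qed.

(** * The list of subgroups of the alternating group *)

(** Conjugation by [h], whose inverse [h'] is supplied. *)
Definition conj6 (h h' s : perm6) : perm6 := mul (mul h' s) h.
Definition g1 := P6 p0 p1 p2 p4 p5 p3.
Definition g1' := P6 p0 p1 p2 p5 p3 p4.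
Definition g2 := P6 p1 p2 p3 p4 p0 p5.
Definition g2' := P6 p4 p0 p1 p2 p3 p5.

Definition make_row (gens : seq perm6) : row := (gens, span_trie gens).
(** Closes a list of subgroups under conjugation by the two generators of A_6. *)
Fixpoint class_rows (k : nat) (found todo : seq row) : seq row :=
  match k, todo with
  | k1.+1, r :: todo1 =>
    let extend q st :=
      if has (fun q1 => below q q1 && below q1 q) st.1 then st
      else (rcons st.1 q, rcons st.2 q) in
    let: (found2, todo2) :=
      extend (make_row (map (conj6 g2 g2') r.1))
        (extend (make_row (map (conj6 g1 g1') r.1)) (found, todo1)) in
    class_rows k1 found2 todo2
  | _, _ => found
  end.

(** One subgroup from each conjugacy class, by increasing order: the trivial
group, C2, C3 (two classes), V4 (two), C4, C5, S3 (two), D8, C3^2, D10,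
A4 (two), C3^2:C2, S4 (two), C3^2:C4, A5 (two) and A6. *)
Definition representatives : seq (seq perm6) :=
 [:: [::];
 [:: P6 p0 p1 p3 p2 p5 p4];
 [:: P6 p0 p1 p2 p4 p5 p3];
 [:: P6 p1 p2 p0 p4 p5 p3];
 [:: P6 p0 p1 p3 p2 p5 p4; P6 p0 p1 p4 p5 p2 p3];
 [:: P6 p0 p1 p3 p2 p5 p4; P6 p1 p0 p2 p3 p5 p4];
 [:: P6 p1 p0 p4 p5 p3 p2];
 [:: P6 p0 p2 p3 p4 p5 p1];
 [:: P6 p0 p1 p2 p4 p5 p3; P6 p0 p2 p1 p3 p5 p4];
 [:: P6 p0 p1 p3 p2 p5 p4; P6 p2 p4 p0 p3 p1 p5];
 [:: P6 p0 p1 p4 p5 p2 p3; P6 p1 p0 p2 p3 p5 p4];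
 [:: P6 p0 p1 p2 p4 p5 p3; P6 p1 p2 p0 p3 p4 p5];
 [:: P6 p0 p1 p3 p2 p5 p4; P6 p0 p2 p1 p4 p3 p5];
 [:: P6 p0 p1 p2 p4 p5 p3; P6 p0 p1 p3 p2 p5 p4];
 [:: P6 p0 p1 p3 p2 p5 p4; P6 p2 p3 p4 p5 p0 p1];
 [:: P6 p0 p1 p2 p4 p5 p3; P6 p0 p2 p1 p3 p5 p4; P6 p1 p0 p2 p3 p5 p4];
 [:: P6 p0 p1 p2 p4 p5 p3; P6 p1 p0 p3 p2 p4 p5];
 [:: P6 p0 p1 p4 p5 p2 p3; P6 p2 p3 p1 p0 p5 p4];
 [:: P6 p0 p1 p2 p4 p5 p3; P6 p3 p4 p5 p0 p2 p1];
 [:: P6 p0 p1 p2 p4 p5 p3; P6 p0 p2 p3 p1 p4 p5];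
 [:: P6 p0 p1 p3 p2 p5 p4; P6 p1 p2 p0 p5 p3 p4];
 [:: g1; g2]].

(** Consecutive classes have nondecreasing orders, so a subgroup appears after
its proper subgroups. *)
Definition rows : seq row :=
  Eval vm_compute in flatten [seq let r := make_row gens in class_rows 400 [:: r] [:: r]
                             | gens <- representatives].

Fixpoint numbered_from (A : Type) (i : positive) (l : seq A) : seq (positive * A) :=
  if l is x :: l1 then (i, x) :: numbered_from (Pos.succ i) l1 else [::].
Definition numbered A (l : seq A) := numbered_from 1 l.

Definition row_map : pmap row :=
  Eval vm_compute in
  foldl (fun m ir => PositiveMap.add ir.1 ir.2 m) (PositiveMap.empty _) (numbered rows).
(** In decreasing order, so that a search meets large subgroups first. *)
Definition ids : seq positive := Eval vm_compute in rev (map fst (numbered rows)).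
Definition row_of (i : positive) : row :=
  if PositiveMap.find i row_map is Some r then r else ([::], Empty).
Definition listed (i : positive) : {group 'S_6} := group_of (row_of i).1.
Definition le_id (i j : positive) : bool := below (row_of i) (row_of j).

Lemma rows_ok : all (fun i => row_ok (row_of i)) ids.
Proof. by vm_compute. Qed.

Lemma row_of_ok i : i \in ids -> row_ok (row_of i).
Proof. exact: (allP rows_ok). Qed.

Lemma le_idP i j : i \in ids -> j \in ids -> le_id i j = (listed i \subset listed j).
Proof. by move=> /row_of_ok oki /row_of_ok okj; exact: belowP. Qed.

Definition A6_id : positive := 501.
Definition A6 : {group 'S_6} := group_of [:: g1; g2].

Lemma leq_card_group_of gens L : all is_perm gens -> uniq L ->
  all (mem_trie (span_trie gens)) L -> size L <= #|group_of gens|.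
Proof.
move=> pg uL /allP allL; rewrite cardE -(size_map code (enum _)).
apply: uniq_leq_size uL _ => p /allL /(mem_span_trie pg)[s sG <-].
by rewrite map_f // mem_enum.
Qed.

(** Both generators have odd order, hence are even permutations, and 360 different
elements are found in the group that they generate. *)
Lemma A6E : A6 = ('Alt_('I_6))%G.
Proof.
have sA : A6 \subset 'Alt_('I_6).
  rewrite gen_subG; apply/subsetP=> s /[1!inE]; rewrite inE mem_seq1 => sg.
  rewrite Alt_even; apply/negP=> odd_s.
  have odd1 : odd_perm (1 : 'S_6) = false := odd_perm1 _.
  case/orP: sg => /eqP sg.
    have s3 : s * (s * s) = 1 by apply: code_inj; rewrite !codeM code1 sg.
    by move: odd1; rewrite -s3 !odd_permM odd_s.
  have s5 : s * (s * (s * (s * s))) = 1 by apply: code_inj; rewrite !codeM code1 sg.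
  by move: odd1; rewrite -s5 !odd_permM odd_s.
apply/val_inj/eqP; rewrite eqEcard sA /=.
have /eqP card_Alt6 : #|'Alt_('I_6)| == 360.
  by rewrite -(eqn_pmul2l (isT : 0 < 2)) card_Alt card_ord.
have [L [uL sL allL]] : exists L,
    [/\ uniq L, size L == 360 & all (mem_trie (span_trie [:: g1; g2])) L].
  by exists (elements (span_trie [:: g1; g2])); split; vm_compute.
have := leq_card_group_of (isT : all is_perm [:: g1; g2]) uL allL.
by rewrite card_Alt6 (eqP sL).
Qed.

(** * Orbits of pairs of subgroups *)

Definition row_image (h h' : perm6) (i : positive) : positive :=
  let r := make_row (map (conj6 h h') (row_of i).1) in
  head 1%positive [seq j <- ids | below r (row_of j) && below (row_of j) r].
Definition action (h h' : perm6) : pmap positive :=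
  foldl (fun m i => PositiveMap.add i (row_image h h' i) m) (PositiveMap.empty _) ids.
Definition act1 : pmap positive := Eval vm_compute in action g1 g1'.
Definition act2 : pmap positive := Eval vm_compute in action g2 g2'.
Definition act (m : pmap positive) (i : positive) : positive :=
  if PositiveMap.find i m is Some j then j else 1%positive.

(** Testing generators in both directions gives both inclusions between the
conjugate of subgroup [i] and subgroup [act m i]. *)
Definition acts_by (h h' : perm6) (m : pmap positive) : bool :=
  all (fun i => let j := act m i in
    [&& j \in ids, all (fun g => mem_trie (row_of j).2 (conj6 h h' g)) (row_of i).1
      & all (fun g => mem_trie (row_of i).2 (conj6 h' h g)) (row_of j).1]) ids.

Lemma act1_ok : acts_by g1 g1' act1. Proof. by vm_compute. Qed.

Lemma act2_ok : acts_by g2 g2' act2. Proof. by vm_compute. Qed.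

Definition c1 := decode g1.
Definition c2 := decode g2.
Lemma code_c1 : code c1 = g1. Proof. exact: decodeK. Qed.

Lemma code_c2 : code c2 = g2. Proof. exact: decodeK. Qed.

Lemma codeV s p : is_perm p -> mul (code s) p = one -> code s^-1 = p.
Proof.
move=> /is_permP[t <-]; rewrite -codeM -code1 => /code_inj st.
by congr code; apply: (mulgI s); rewrite mulgV st.
Qed.

Lemma A6_gen : A6 :=: <<[set c1; c2]>>.
Proof.
congr <<_>>; apply/setP=> s; rewrite !inE -code_c1 -code_c2.
by rewrite !(inj_eq code_inj).
Qed.

Lemma actP s h' m : is_perm h' -> mul (code s) h' = one -> acts_by (code s) h' m ->
  forall i, i \in ids -> act m i \in ids /\ listed (act m i) :=: listed i :^ s.
Proof.
move=> ph' sh' /allP acts i iI; have /and3P[jI /allP ij /allP ji] := acts i iI.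
have [oki okj] := (row_of_ok iI, row_of_ok jI).
have cJ t : code (t ^ s) = conj6 (code s) h' (code t).
  by rewrite conjgE mulgA !codeM (codeV ph' sh') /conj6.
have cJV t : code (t ^ s^-1) = conj6 h' (code s) (code t).
  by rewrite conjgE invgK mulgA !codeM (codeV ph' sh') /conj6.
split=> //; apply/eqP; rewrite eqEsubset sub_conjg !gen_subG.
apply/andP; split; apply/subsetP=> t; rewrite inE => tg.
  by rewrite mem_conjg -(row_okP oki) cJV ji //.
by rewrite mem_conjgV -(row_okP okj) cJ ij //.
Qed.

Notation ptable := (pmap (pmap positive)).
Definition get (M : ptable) (i j : positive) : option positive :=
  if PositiveMap.find i M is Some Mi then PositiveMap.find j Mi else None.
Definition put (M : ptable) (i j v : positive) : ptable :=
  PositiveMap.add i (PositiveMap.add j v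
    (if PositiveMap.find i M is Some Mi then Mi else PositiveMap.empty _)) M.

Lemma get_put M i j v i1 j1 :
  get (put M i j v) i1 j1 = if (i1 == i) && (j1 == j) then Some v else get M i1 j1.
Proof.
rewrite /get /put find_add; case: eqP => //= ->; rewrite find_add; case: eqP => //= _.
by case: (PositiveMap.find i M) => //; rewrite PositiveMap.gempty.
Qed.

Definition push (v : positive) (m : pmap positive) (i j : positive)
    (st : ptable * seq (positive * positive)) :=
  let i1 := act m i in let j1 := act m j in
  if get st.1 i1 j1 is Some _ then st else (put st.1 i1 j1 v, (i1, j1) :: st.2).
(** Gives the label [v] to the whole orbit of the pairs in [todo]. *)
Fixpoint flood (k : nat) (v : positive) (M : ptable) (todo : seq (positive * positive)) : ptable :=
  match k, todo with
  | k1.+1, (i, j) :: todo1 =>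
    let: (M2, todo2) := push v act2 i j (push v act1 i j (M, todo1)) in flood k1 v M2 todo2
  | _, _ => M
  end.

(** One pair from each orbit; the last 22 are those of the form (K, K).  The
position of a pair is its variable in the formula.  The order of the first 110
pairs comes from a local search for a short run of [count_models]; any other
order gives the same number of models. *)
Definition orbit_roots : seq (positive * positive) :=
  Eval compute in [::
    (1,258); (18,198); (1,2); (1,318); (2,501); (449,501); (464,501);
    (479,501); (489,501); (495,501); (424,501); (373,501); (1,501); (1,409);
    (2,102); (409,501); (72,258); (2,117); (2,258); (47,198); (1,47); (1,117);
    (1,495); (439,501); (363,501); (2,449); (87,501); (67,501); (47,501);
    (2,464); (2,489); (12,479); (318,464); (2,495); (318,449); (318,501);
    (1,373); (102,318); (2,373); (2,87); (1,198); (87,318); (1,439); (117,501);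
    (1,464); (1,479); (47,409); (3,318); (1,67); (258,501); (162,501);
    (198,501); (1,449); (1,424); (2,424); (69,424); (1,489); (12,318);
    (102,501); (2,409); (12,439); (117,318); (67,439); (47,439); (102,424);
    (87,409); (11,449); (3,464); (363,439); (163,373); (439,479); (272,439);
    (198,439); (1,102); (1,87); (68,495); (47,489); (69,464); (47,449);
    (1,363); (102,495); (87,489); (163,495); (162,489); (67,479); (47,479);
    (363,479); (102,449); (87,464); (198,489); (258,495); (102,464); (409,449);
    (424,495); (409,489); (2,318); (261,464); (211,449); (272,479); (198,479);
    (127,479); (117,449); (117,464); (373,495); (373,489); (424,464); (87,449);
    (67,363); (47,363); (1,162)]%positive ++
  [seq (i, i) | i <- [:: 1; 2; 47; 67; 87; 102; 117; 162; 198; 258; 318; 363; 373; 409;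
    424; 439; 449; 464; 479; 489; 495; 501]%positive].
Definition labels : seq positive := Eval vm_compute in map fst (numbered orbit_roots).
Definition root (v : positive) : positive * positive :=
  nth (1, 1)%positive orbit_roots (Pos.to_nat v).-1.

Definition flood_roots (vs : seq positive) : ptable :=
  foldl (fun M v => let: (i, j) := root v in flood 400 v (put M i j v) [:: (i, j)])
    (PositiveMap.empty _) vs.
Definition orbits : ptable := Eval vm_compute in flood_roots labels.
Lemma orbitsE : orbits = flood_roots labels. Proof. by vm_compute. Qed.

Definition pair_label (i j : positive) : positive :=
  if get orbits i j is Some v then v else 1%positive.

(** The pair (i, j) is conjugate to the root of the orbit [v]. *)
Definition linked (v i j : positive) : Prop :=
  [/\ i \in ids, j \in ids & exists2 x, x \in A6 &
     listed i :=: listed (root v).1 :^ x /\ listed j :=: listed (root v).2 :^ x].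

Definition table_sound (M : ptable) := forall i j v, get M i j = Some v -> linked v i j.

Lemma root_ids : all (fun v => let: (i, j) := root v in
  [&& i \in ids, j \in ids, le_id i j & get orbits i j == Some v]) labels.
Proof. by vm_compute. Qed.

Lemma linked_act v i j s h' m : is_perm h' -> mul (code s) h' = one -> acts_by (code s) h' m ->
  s \in A6 -> linked v i j -> linked v (act m i) (act m j).
Proof.
move=> ph' sh' acts sA [iI jI [x xA [iE jE]]].
have [aiI aiE] := actP ph' sh' acts iI; have [ajI ajE] := actP ph' sh' acts jI.
by split=> //; exists (x * s); rewrite ?groupM // aiE ajE iE jE !conjsgM.
Qed.

Lemma c1A : c1 \in A6. Proof. by rewrite A6_gen mem_gen // !inE eqxx. Qed.

Lemma c2A : c2 \in A6. Proof. by rewrite A6_gen mem_gen // !inE eqxx orbT. Qed.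

Lemma linked_act1 v i j : linked v i j -> linked v (act act1 i) (act act1 j).
Proof. by apply: (@linked_act _ _ _ c1 g1'); rewrite ?code_c1 ?c1A // act1_ok. Qed.

Lemma linked_act2 v i j : linked v i j -> linked v (act act2 i) (act act2 j).
Proof. by apply: (@linked_act _ _ _ c2 g2'); rewrite ?code_c2 ?c2A // act2_ok. Qed.

Lemma floodP k v M todo : table_sound M -> (forall p, p \in todo -> linked v p.1 p.2) ->
  table_sound (flood k v M todo).
Proof.
elim: k M todo => [|k IH] M [|[i j] todo] //= sM st.
have lij : linked v i j by apply: (st (i, j)); exact: mem_head.
have {}st p : p \in todo -> linked v p.1 p.2 by move=> pt; apply: st; rewrite inE pt orbT.
pose ok (st : ptable * seq (positive * positive)) :=
  table_sound st.1 /\ (forall p, p \in st.2 -> linked v p.1 p.2).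
have pushP m st1 : linked v (act m i) (act m j) -> ok st1 -> ok (push v m i j st1).
  move=> lm [s1 s2]; rewrite /push; case: get => //; split=> [a b w|p] /=.
    by rewrite get_put; case: andP => [[/eqP-> /eqP->] [<-] //|_ /s1].
  by rewrite inE => /orP[/eqP->|/s2].
have := pushP act2 _ (linked_act2 lij) (pushP act1 (M, todo) (linked_act1 lij) (conj sM st)).
by case: push => M2 todo2 [/= ? ?]; apply: IH.
Qed.

Arguments flood : simpl never.
(** Flooding only moves pairs by elements of A_6. *)
Lemma orbits_sound : table_sound orbits.
Proof.
rewrite orbitsE /flood_roots.
have: {subset labels <= labels} by [].
move: {1 3}labels => vs; have: table_sound (PositiveMap.empty _).
  by move=> i j v; rewrite /get PositiveMap.gempty.
elim: vs (PositiveMap.empty _) => //= v vs IH M sM svs.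
apply: IH => [|w wvs]; last by rewrite svs // inE wvs orbT.
have /(allP root_ids) := svs v (mem_head _ _).
case E: (root v) => [i j] /and4P[iI jI _ _].
have lij : linked v i j by split=> //; exists 1; rewrite ?group1 // E !conjsg1.
apply: floodP => [a b w|p]; last by rewrite mem_seq1 => /eqP->.
by rewrite get_put; case: andP => [[/eqP-> /eqP->] [<-] //|_ /sM].
Qed.

(** Inclusion refines the numerical order, and the label of a pair is invariant
under the two generators of A_6. *)
Definition pair_ok (i j : positive) : bool :=
  if ~~ le_id i j then true else
  Pos.leb i j &&
  if get orbits i j is Some v then
    [&& Pos.leb v 132, get orbits (act act1 i) (act act1 j) == Some v
      & get orbits (act act2 i) (act act2 j) == Some v]
  else false.
Lemma pairs_ok : all (fun i => all (pair_ok i) ids) ids.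
Proof. by vm_compute. Qed.

(** * Completeness of the list of subgroups *)

(* Unification should not evaluate the tables. *)
Opaque ids row_map orbits act1 act2.

Lemma listed_inj : {in ids &, forall i j, listed i :=: listed j -> i = j}.
Proof.
move=> i j iI jI eqD.
have := allP (allP pairs_ok _ jI) _ iI; have := allP (allP pairs_ok _ iI) _ jI.
rewrite /pair_ok !le_idP // eqD subxx /= => /andP[/Pos.leb_le ij _] /andP[/Pos.leb_le ji _].
exact: Pos.le_antisym.
Qed.

Lemma le_id_get i j : i \in ids -> j \in ids -> listed i \subset listed j ->
  exists2 v, Pos.leb v 132 & [/\ get orbits i j = Some v,
    get orbits (act act1 i) (act act1 j) = Some v & get orbits (act act2 i) (act act2 j) = Some v].
Proof.
move=> iI jI; rewrite -le_idP // => ij; have := allP (allP pairs_ok _ iI) _ jI.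
rewrite /pair_ok ij /= => /andP[_]; case: get => // v /and3P[v132 /eqP-> /eqP->].
by exists v.
Qed.

Lemma A6_ind (P : 'S_6 -> Prop) : P 1 ->
  (forall x y, x \in A6 -> P x -> P y -> P (x * y)) -> P c1 -> P c2 ->
  forall x, x \in A6 -> P x.
Proof.
move=> P1 PM Pc1 Pc2 x; rewrite A6_gen => /gen_prodgP[n [c cA ->]].
suff [] : \prod_i c i \in A6 /\ P (\prod_i c i) by [].
apply: (big_ind (fun y => y \in A6 /\ P y)) => [|y z [yA Py] [zA Pz]|i _].
- by rewrite group1.
- by rewrite groupM //; split=> //; apply: PM.
by case/set2P: (cA i) => ->; rewrite ?c1A ?c2A.
Qed.

Lemma act1P i : i \in ids -> act act1 i \in ids /\ listed (act act1 i) :=: listed i :^ c1.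
Proof. by apply: (@actP c1 g1'); rewrite ?code_c1 // act1_ok. Qed.

Lemma act2P i : i \in ids -> act act2 i \in ids /\ listed (act act2 i) :=: listed i :^ c2.
Proof. by apply: (@actP c2 g2'); rewrite ?code_c2 // act2_ok. Qed.

Lemma listed_conj x : x \in A6 -> forall i, i \in ids ->
  exists2 j, j \in ids & listed j :=: listed i :^ x.
Proof.
apply: (A6_ind (P := fun x => forall i, i \in ids ->
  exists2 j, j \in ids & listed j :=: listed i :^ x)) => {x}.
- by move=> i iI; exists i; rewrite ?conjsg1.
- move=> x y _ IHx IHy i /IHx[j /IHy[k kI kE] jE]; exists k => //.
  by rewrite kE jE conjsgM.
- by move=> i /act1P[? ?]; exists (act act1 i).
- by move=> i /act2P[? ?]; exists (act act2 i).
Qed.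

(** The elements of A_6 that preserve all labels are closed under products, so
the check for the two generators is enough. *)
Lemma get_conj x : x \in A6 -> forall i j i1 j1,
  [/\ i \in ids, j \in ids, i1 \in ids & j1 \in ids] -> listed i \subset listed j ->
  listed i1 :=: listed i :^ x -> listed j1 :=: listed j :^ x -> get orbits i1 j1 = get orbits i j.
Proof.
pose P x := forall i j i1 j1,
  [/\ i \in ids, j \in ids, i1 \in ids & j1 \in ids] -> listed i \subset listed j ->
  listed i1 :=: listed i :^ x -> listed j1 :=: listed j :^ x -> get orbits i1 j1 = get orbits i j.
suff base m c : c \in A6 ->
   (forall i, i \in ids -> act m i \in ids /\ listed (act m i) :=: listed i :^ c) ->
   (forall i j, i \in ids -> j \in ids -> listed i \subset listed j ->
     get orbits (act m i) (act m j) = get orbits i j) -> P c.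
  apply: (A6_ind (P := P)) => {x}.
  - move=> i j i1 j1 [iI jI i1I j1I] _; rewrite !conjsg1 => /listed_inj-> // /listed_inj-> //.
  - move=> x y xA Px Py i j i2 j2 [iI jI i2I j2I] sij i2E j2E.
    have [i1 i1I i1E] := listed_conj xA iI; have [j1 j1I j1E] := listed_conj xA jI.
    rewrite -(Px i j i1 j1) //; apply: Py => //; first by rewrite i1E j1E conjSg.
      by rewrite i2E i1E conjsgM.
    by rewrite j2E j1E conjsgM.
  - apply: (base act1 _ c1A act1P) => i j iI jI /(le_id_get iI jI)[v _ [-> -> _]] //.
  - apply: (base act2 _ c2A act2P) => i j iI jI /(le_id_get iI jI)[v _ [-> _ ->]] //.
move=> cA actm getm i j i1 j1 [iI jI i1I j1I] sij i1E j1E.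
have [[aiI aiE] [ajI ajE]] := (actm i iI, actm j jI).
have <- : act m i = i1 by apply: listed_inj; rewrite // aiE i1E.
have <- : act m j = j1 by apply: listed_inj; rewrite // ajE j1E.
exact: getm.
Qed.

Lemma A6_ids : A6_id \in ids. Proof. by vm_compute. Qed.

Lemma listed_A6 : listed A6_id = A6.
Proof. by congr group_of; apply/eqP; vm_compute. Qed.

Lemma ids_le_A6 : all (fun i => le_id i A6_id) ids.
Proof. by vm_compute. Qed.

Lemma listed_sub_A6 i : i \in ids -> listed i \subset A6.
Proof.
move=> iI; rewrite -listed_A6 -le_idP ?A6_ids //.
exact: (allP ids_le_A6).
Qed.

(** Tests that every element [x] of [xs] outside subgroup [r] generates with it a
group that contains a listed subgroup larger than [r].  This property passes
from [y] to [x] when [y] lies in the group generated by [r] and [x]; therefore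
the search started at [x] may stop at an element already known to be good, and
only a few searches have to be completed. *)
Fixpoint all_extend (r : positive) (T : trie) (gens : seq perm6) (good : trie)
    (xs : seq perm6) : bool :=
  if xs isn't x :: xs1 then true else
  if mem_trie T x then all_extend r T gens good xs1 else
  if explore 400 (x :: gens) good (add_trie x Empty) [:: x] is Some X then
    has (fun m => [&& le_id r m, ~~ Pos.eqb r m & all (mem_trie X) (row_of m).1]) ids
    && all_extend r T gens (add_trie x good) xs1
  else all_extend r T gens (add_trie x good) xs1.

Definition class_roots : seq positive :=
  [seq (root v).1 | v <- labels & Pos.eqb (root v).1 (root v).2].

Lemma class_roots_extendP :
  all (fun r => let: (gens, T) := row_of r in
    all_extend r T gens Empty (elements (row_of A6_id).2)) class_roots.
Proof. by vm_compute. Qed.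

(** Stated for all groups containing subgroup [r] and [x], which avoids naming the
group that they generate. *)
Definition extends (r : positive) (x : perm6) : Prop :=
  forall K : {group 'S_6}, listed r \subset K -> in_code K x ->
  exists2 m, m \in ids & (listed r \proper listed m) && (listed m \subset K).

Arguments explore : simpl never.
Lemma all_extendP r T gens good xs : r \in ids -> row_of r = (gens, T) ->
  (forall x, mem_trie good x -> extends r x) -> all_extend r T gens good xs ->
  forall x, x \in xs -> mem_trie T x \/ extends r x.
Proof.
move=> rI rE; elim: xs good => //= y xs IH good goodP.
case: ifP => [Ty|_] H x.
  by rewrite inE => /orP[/eqP->|/(IH _ goodP H)] //; left.
suff [ey H1] : extends r y /\ all_extend r T gens (add_trie y good) xs.
  rewrite inE => /orP[/eqP->|]; first by right.
  by apply: (IH _ _ H1) => z /mem_add[->|/goodP].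
have ok_r := row_of_ok rI.
have pg : all is_perm (row_of r).1 by move: ok_r; rewrite rE => /and4P[].
suff H2 : extends r y by split=> //; move: H; case: explore => // X /andP[].
move=> K rK Ky.
have Kgens g : g \in y :: gens -> in_code K g.
  rewrite inE => /orP[/eqP->//|gg].
  have [|s sr sg] := @in_group_of (row_of r).1 g pg; first by rewrite rE.
  by exists s => //; apply: (subsetP rK).
have Ktodo z : z \in [:: y] -> in_code K z by rewrite mem_seq1 => /eqP->.
have KT p : mem_trie (add_trie y Empty) p -> in_code K p.
  by case/mem_add=> [->|] //; rewrite /mem_trie has_word_Empty.
have := exploreP 400 good Kgens Ktodo KT.
case: explore H => [X|_ [z gz Kz]]; last exact: (goodP z gz).
case/andP=> /hasP[m mI /and3P[rm nrm /allP mX]] _ KX; exists m => //; apply/andP; split.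
  rewrite properEneq -le_idP // rm andbT; apply: contra nrm => /eqP.
  by move/listed_inj=> -> //; exact: Pos.eqb_refl.
rewrite gen_subG; apply/subsetP=> s; rewrite inE => sm.
by have [t tK /code_inj<-] := KX _ (mX _ sm).
Qed.

Lemma labelsP v : Pos.leb v 132 -> v \in labels.
Proof.
have /allP labelled : all (fun n => Pos.of_nat n \in labels) (iota 1 132) by vm_compute.
move/Pos.leb_le/Pos2Nat.inj_le/leP => v132; rewrite -(Pos2Nat.id v); apply: labelled.
by rewrite mem_iota; apply/andP; split=> //; apply/ltP; exact: Pos2Nat.is_pos.
Qed.

Lemma one_ids : 1%positive \in ids. Proof. by vm_compute. Qed.

Lemma listed1 : listed 1 :=: 1.
Proof.
rewrite /listed; have -> : (row_of 1).1 = [::] by vm_compute.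
by rewrite -gen0; congr <<_>>; apply/setP=> s; rewrite !inE.
Qed.

(** The label of the pair (i, i) leads to a root, which is of the form (r, r). *)
Lemma class_rootP i : i \in ids ->
  exists r, [/\ r \in class_roots, r \in ids & exists2 x, x \in A6 & listed i :=: listed r :^ x].
Proof.
move=> iI; have [v v132 [gi _ _]] := le_id_get iI iI (subxx _).
have [_ _ [x xA [E1 E2]]] := orbits_sound gi.
have vL := labelsP v132; have := allP root_ids v vL.
case E: (root v) E1 E2 => [r q] /= E1 E2 /and4P[rI qI _ _].
exists r; split=> //; last by exists x.
have rq : r = q by apply: listed_inj => //; apply: (can_inj (conjsgK x)); rewrite -E1 E2.
apply/mapP; exists v; last by rewrite E.
by rewrite mem_filter E /= rq Pos.eqb_refl.
Qed.

Theorem listedP (K : {group 'S_6}) : K \subset A6 -> exists2 i, i \in ids & K :=: listed i.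
Proof.
move=> KA.
pose P n := has (fun i => (listed i \subset K) && (#|listed i| == n)) ids.
have exP : exists n, P n.
  exists #|listed 1|; apply/hasP; exists 1%positive; first exact: one_ids.
  by rewrite eqxx andbT listed1 sub1G.
have ubP n : P n -> n <= #|K|.
  by case/hasP=> i _ /andP[iK /eqP<-]; exact: subset_leq_card.
(* [i] is a listed subgroup of [K] of maximal order, [g] an element outside. *)
case: (ex_maxnP exP ubP) => n /hasP[i iI /andP[iK /eqP iE]] maxn; exists i => //.
apply/eqP; rewrite eqEsubset iK andbT; apply/subsetPn=> -[g gK giN].
(* Conjugation by [x^-1] moves [i] to the representative [r] of its class. *)
have [r [rR rI [x xA rE]]] := class_rootP iI.
have ext := allP class_roots_extendP _ rR.
have good0 x0 : mem_trie Empty x0 -> extends r x0 by rewrite /mem_trie has_word_Empty.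
case E: (row_of r) ext => [gens T] /(all_extendP rI E good0) H.
have gA : g ^ x^-1 \in A6 by rewrite groupJ ?groupV // (subsetP KA).
have [||] := H (code (g ^ x^-1)).
- by apply: mem_elements; rewrite (row_okP (row_of_ok A6_ids)) -/(listed A6_id) listed_A6.
- have -> : T = (row_of r).2 by rewrite E.
  by rewrite (row_okP (row_of_ok rI)) -/(listed r) -mem_conjg -rE (negPf giN).
case/(_ (K :^ x^-1)%G).
- by rewrite /= -sub_conjgV invgK -rE.
- by exists (g ^ x^-1); rewrite ?memJ_conjg.
move=> m mI /andP[rm mK]; have [j jI jE] := listed_conj xA mI.
have : #|listed j| <= n.
  apply: maxn; apply/hasP; exists j => //; rewrite eqxx andbT jE.
  by rewrite sub_conjg.
by rewrite jE cardJg -iE rE cardJg leqNgt proper_card.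
Qed.

(** * Transfer systems as sets of orbits of pairs *)

Section OrbitLabels.
Variables (gT : finGroupType) (G : {group gT}) (n : nat).
Variable o : {group gT} -> {group gT} -> 'I_n.
Implicit Types (H K L : {group gT}) (f : {ffun 'I_n -> bool}).

Hypothesis o_conjg : forall H K x, H \subset K -> K \subset G -> x \in G ->
  o (H :^ x)%G (K :^ x)%G = o H K.
Hypothesis o_inj : forall H K H1 K1, H \subset K -> K \subset G -> H1 \subset K1 -> K1 \subset G ->
  o H K = o H1 K1 -> exists2 x, x \in G & H1 = (H :^ x)%G /\ K1 = (K :^ x)%G.
Hypothesis o_surj : forall v, exists H K, [/\ H \subset K, K \subset G & o H K = v].

(** The axioms of a transfer system, for the relation made of the pairs (H, K)
with [f (o H K)]. *)
Definition transfer_labels f : Prop :=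
  [/\ forall K, K \subset G -> f (o K K),
      forall H K L, H \subset K -> K \subset L -> L \subset G ->
        f (o H K) -> f (o K L) -> f (o H L)
    & forall H K L, H \subset K -> L \subset K -> K \subset G ->
        f (o H K) -> f (o (H :&: L)%G L)].

Definition relation_of f : {set {group gT} * {group gT}} :=
  [set p : {group gT} * {group gT} | [&& p.1 \subset p.2, p.2 \subset G & f (o p.1 p.2)]].

Definition labels_of (R : {set {group gT} * {group gT}}) : {ffun 'I_n -> bool} :=
  [ffun v => [exists p : {group gT} * {group gT}, (p \in R) && (o p.1 p.2 == v)]].

Lemma relation_of_inj : injective relation_of.
Proof.
move=> f g /setP efg; apply/ffunP=> v; have [H [K [HK KG <-]]] := o_surj v.
by have := efg (H, K); rewrite !inE HK KG.
Qed.

Lemma relation_of_transfer f : transfer_labels f -> transfer_system G (relation_of f).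
Proof.
case=> refl_f trans_f restr_f; apply/and4P; split.
- apply/and4P; split.
  + apply/subsetP=> -[H K]; rewrite !inE /= => /and3P[HK KG _].
    by rewrite (subset_trans HK KG) KG.
  + by apply/forall_inP=> K; rewrite inE => KG; rewrite inE /= subxx KG refl_f.
  + apply/forallP=> H; apply/forallP=> K; apply/implyP; rewrite !inE /=.
    case/andP=> /and3P[HK _ _] /and3P[KH _ _].
    by apply/eqP/val_inj/eqP; rewrite /= eqEsubset HK KH.
  + apply/forallP=> H; apply/forallP=> K; apply/forallP=> L; apply/implyP; rewrite !inE /=.
    case/andP=> /and3P[HK KG fHK] /and3P[KL LG fKL].
    by rewrite (subset_trans HK KL) LG (trans_f H K L).
- apply/forallP=> H; apply/forallP=> K; apply/implyP; rewrite inE /=.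
  by case/and3P.
- apply/forall_inP=> g gG; apply/forallP=> H; apply/forallP=> K; apply/implyP; rewrite !inE /=.
  case/and3P=> HK KG fHK; rewrite conjSg HK o_conjg ?groupV // fHK andbT.
  by rewrite sub_conjgV conjGid.
apply/forallP=> H; apply/forallP=> K; apply/forallP=> L; apply/implyP; rewrite !inE /=.
case/andP=> /and3P[HK KG fHK] LK; rewrite subsetIr (subset_trans LK KG).
exact: (restr_f H K L).
Qed.

Section OfTransferSystem.
Variable R : {set {group gT} * {group gT}}.
Hypothesis tsR : transfer_system G R.

Lemma transfer_sub H K : (H, K) \in R -> (H \subset K) && (K \subset G).
Proof.
move=> HKR; case/and4P: tsR => /and4P[/subsetP sR _ _ _] /forallP/(_ H)/forallP/(_ K) + _ _.
rewrite HKR /= => ->; by have := sR _ HKR; rewrite !inE => /andP[_ ->].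
Qed.

Lemma transfer_conjg H K x : x \in G -> (H, K) \in R -> ((H :^ x)%G, (K :^ x)%G) \in R.
Proof.
move=> xG HKR; case/and4P: tsR => _ _ /forall_inP/(_ x^-1) + _; rewrite groupV => /(_ xG).
by move/forallP/(_ H)/forallP/(_ K); rewrite HKR invgK.
Qed.

Lemma labels_ofE H K : H \subset K -> K \subset G -> labels_of R (o H K) = ((H, K) \in R).
Proof.
move=> HK KG; rewrite ffunE; apply/existsP/idP => [[[H1 K1] /= /andP[R1 /eqP e1]]|HKR]; last first.
  by exists (H, K); rewrite HKR eqxx.
have /andP[HK1 KG1] := transfer_sub R1.
by have [x xG [-> ->]] := o_inj HK1 KG1 HK KG e1; apply: transfer_conjg.
Qed.

Lemma labels_of_transfer : transfer_labels (labels_of R).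
Proof.
case/and4P: (tsR) => /and4P[_ /forall_inP reflR _ /forallP transR] _ _ /forallP restrR.
split=> [K KG|H K L HK KL LG|H K L HK LK KG].
- by rewrite labels_ofE // reflR // inE.
- have KG := subset_trans KL LG; rewrite !labels_ofE ?(subset_trans HK) // => HKR KLR.
  by move/(_ H)/forallP/(_ K)/forallP/(_ L): transR; rewrite HKR KLR.
rewrite !labels_ofE ?subsetIr ?(subset_trans LK) // => HKR.
by move/(_ H)/forallP/(_ K)/forallP/(_ L): restrR; rewrite HKR LK.
Qed.

Lemma relation_of_labels : relation_of (labels_of R) = R.
Proof.
apply/setP=> -[H K]; rewrite inE /=; apply/and3P/idP => [[HK KG]|HKR]; first by rewrite labels_ofE.
by have /andP[HK KG] := transfer_sub HKR; rewrite labels_ofE.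
Qed.

End OfTransferSystem.

(** A transfer system is recovered from the labels of its pairs because it is
closed under conjugation. *)
Theorem card_transfer_systems (A : {set {ffun 'I_n -> bool}}) :
  (forall f, f \in A <-> transfer_labels f) -> #|transfer_systems G| = #|A|.
Proof.
move=> AP; rewrite -(card_imset _ relation_of_inj); apply: eq_card => R; rewrite inE.
apply/idP/imsetP => [tsR|[f /AP fA ->]]; last exact: relation_of_transfer.
by exists (labels_of R); rewrite ?relation_of_labels //; apply/AP/labels_of_transfer.
Qed.

End OrbitLabels.

(** * The formula for the alternating group and its models *)

Opaque labels listed.

Definition lower (k : positive) : seq positive := [seq l <- ids | le_id l k].
Fixpoint first_below (ls : seq positive) (r : row) : positive :=
  if ls is l :: ls1 then if below (row_of l) r then l else first_below ls1 r else 1%positive.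
Fixpoint dedup (seen : pset) (s : seq positive) : seq positive :=
  if s is x :: s1 then
    if pset_mem x seen then dedup seen s1 else x :: dedup (pset_add x seen) s1
  else [::].

(** The axioms for the root (h, k) of the orbit [v]: reflexivity, the restrictions
of h -> k to the subgroups l of k, and the compositions of l -> h with h -> k.
By conjugation these cover all instances.  Clauses in which the conclusion is
one of the premises are dropped. *)
Definition clauses_at (v : positive) : cnf :=
  let: (h, k) := root v in
  let ls := lower h in
  (if Pos.eqb h k then [:: [:: (true, v)]] else [::]) ++
  [seq [:: (false, v); (true, w)]
     | w <- dedup pset0 [seq pair_label (first_below ls (row_of l)) l | l <- lower k]
     & ~~ Pos.eqb w v] ++
  [seq [:: (false, aw.1); (false, v); (true, aw.2)]
     | aw <- undup [seq (pair_label l h, pair_label l k) | l <- ls]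
     & ~~ Pos.eqb aw.2 v && ~~ Pos.eqb aw.2 aw.1].
Definition transfer_cnf : cnf := Eval vm_compute in flatten [seq clauses_at v | v <- labels].
Lemma transfer_cnfE : transfer_cnf = flatten [seq clauses_at v | v <- labels].
Proof. by vm_compute. Qed.

Opaque transfer_cnf.

Lemma pos_eqbE (x y : positive) : Pos.eqb x y = (x == y).
Proof. by []. Qed.

Lemma mem_dedup seen s x : (x \in dedup seen s) = (x \in s) && ~~ pset_mem x seen.
Proof.
elim: s seen => //= y s IH seen; rewrite inE; case: ifP => ys.
  by rewrite IH; case: eqP => //= ->; rewrite ys andbF.
rewrite inE IH pset_mem_add negb_or; case: (x =P y) => //= ->; by rewrite ys.
Qed.

Lemma sat_flatten n (f : {ffun 'I_n -> bool}) (s : seq cnf) :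
  sat f (flatten s) = all (sat f) s.
Proof. by elim: s => //= F s IH; rewrite sat_cat IH. Qed.

Lemma sat_clauses_at n (f : {ffun 'I_n -> bool}) v h k : root v = (h, k) ->
  sat f (clauses_at v) <->
  [/\ h = k -> value f v,
      {in lower k, forall l, value f v -> value f (pair_label (first_below (lower h) (row_of l)) l)}
    & {in lower h, forall l, value f (pair_label l h) -> value f v -> value f (pair_label l k)}].
Proof.
rewrite /clauses_at => ->; rewrite !sat_cat.
have diagP : sat f (if Pos.eqb h k then [:: [:: (true, v)]] else [::]) <-> (h = k -> value f v).
  case: (Pos.eqb_spec h k) => [->|nhk] /=; last by split.
  by rewrite /holds /= orbF andbT eqb_id; split=> // H; apply: H.
set R := [seq [:: (false, v); _] | _ <- _ & _].
have restrP : sat f R <->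
    {in lower k, forall l, value f v -> value f (pair_label (first_below (lower h) (row_of l)) l)}.
  rewrite /R /sat all_map all_filter; split=> [/allP H l lk fv|H]; last first.
    apply/allP=> w; rewrite mem_dedup => /andP[/mapP[l lk ->] _].
    by apply/implyP=> _; rewrite /= /holds /= orbF eqb_id eqbF_neg -implybE; apply/implyP/H.
  set w := pair_label _ l; have [->//|nwv] := eqVneq w v.
  have /H : w \in dedup pset0 [seq pair_label (first_below (lower h) (row_of l)) l | l <- lower k].
    by rewrite mem_dedup pset_mem0 andbT; apply/mapP; exists l.
  by rewrite /= pos_eqbE nwv /= /holds /= orbF eqb_id eqbF_neg fv.
set T := [seq [:: (false, _); _; _] | _ <- _ & _].
have transP : sat f T <->
    {in lower h, forall l, value f (pair_label l h) -> value f v -> value f (pair_label l k)}.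
  rewrite /T /sat all_map all_filter; split=> [/allP H l lh fa fv|H]; last first.
    apply/allP=> aw; rewrite mem_undup => /mapP[l lh ->].
    apply/implyP=> _; rewrite /= /holds /= orbF eqb_id !eqbF_neg -!implybE.
    by apply/implyP=> fa; apply/implyP; apply: H.
  set w := pair_label l k; have [->//|nwv] := eqVneq w v.
  have [->//|nwa] := eqVneq w (pair_label l h).
  have /H : (pair_label l h, w) \in undup [seq (pair_label l h, pair_label l k) | l <- lower h].
    by rewrite mem_undup; apply/mapP; exists l.
  by rewrite /= !pos_eqbE nwv nwa /= /holds /= orbF eqb_id !eqbF_neg fa fv.
split=> [/and3P[/diagP ? /restrP ? /transP ?]|[/diagP-> /restrP-> /transP->]] //.
Qed.

Lemma ids_sorted : sorted (fun i j => Pos.ltb j i) ids.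
Proof. by vm_compute. Qed.

Lemma le_id_leq i j : i \in ids -> j \in ids -> listed i \subset listed j -> Pos.le i j.
Proof.
move=> iI jI; rewrite -le_idP // => ij; have := allP (allP pairs_ok _ iI) _ jI.
by rewrite /pair_ok ij /= => /andP[/Pos.leb_le].
Qed.

(** The list decreases, so the first member below [r] is the largest one. *)
Lemma first_belowP ls r m : sorted (fun i j => Pos.ltb j i) ls -> m \in ls -> below (row_of m) r ->
  [/\ first_below ls r \in ls, below (row_of (first_below ls r)) r & Pos.le m (first_below ls r)].
Proof.
have gt_trans : transitive (fun i j => Pos.ltb j i).
  by move=> y x z /Pos.ltb_lt yx /Pos.ltb_lt zy; apply/Pos.ltb_lt; exact: Pos.lt_trans yx.
elim: ls => //= l ls IH srt; have /allP gt_l := order_path_min gt_trans srt.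
rewrite inE => /orP[/eqP->|mls] mr.
  by rewrite mr mem_head; split=> //; exact: Pos.le_refl.
case: ifP => [lr|_].
  by rewrite mem_head; split=> //; apply: Pos.lt_le_incl; apply/Pos.ltb_lt/gt_l.
by have [? ? ?] := IH (path_sorted srt) mls mr; rewrite inE; split=> //; apply/orP; right.
Qed.

Lemma mem_lower k l : k \in ids -> (l \in lower k) = (l \in ids) && (listed l \subset listed k).
Proof.
move=> kI; rewrite mem_filter andbC; case lI: (l \in ids) => //=.
by rewrite le_idP.
Qed.

(** The intersection is listed, with number m say.  It is among the candidates,
so the member found has a number at least m; being contained in the
intersection, it also has a number at most m. *)
Lemma meetP h l : h \in ids -> l \in ids ->
  first_below (lower h) (row_of l) \in ids
  /\ listed (first_below (lower h) (row_of l)) :=: listed h :&: listed l.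
Proof.
move=> hI lI; set c := first_below _ _.
have [|m mI mE] := @listedP (listed h :&: listed l)%G.
  exact: subset_trans (subsetIl _ _) (listed_sub_A6 hI).
have srt : sorted (fun i j => Pos.ltb j i) (lower h).
  apply: sorted_filter ids_sorted => y x z /Pos.ltb_lt yx /Pos.ltb_lt zy.
  by apply/Pos.ltb_lt; exact: Pos.lt_trans yx.
have mh : m \in lower h by rewrite mem_lower // mI -mE subsetIl.
have ml : below (row_of m) (row_of l) by rewrite -/(le_id m l) le_idP // -mE subsetIr.
have [] := first_belowP srt mh ml; rewrite -/c mem_lower // => /andP[cI ch].
rewrite -/(le_id c l) le_idP // => cl mc; split=> //.
have cm : Pos.le c m by apply: le_id_leq; rewrite // -mE subsetI ch.
by rewrite (Pos.le_antisym _ _ cm mc) -mE.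
Qed.

(** An opaque existence statement, so that unification never searches the list. *)
Lemma index_exists (H : {group 'S_6}) : {i | H \subset A6 -> i \in ids /\ listed i = H}.
Proof.
exists (nth 1%positive ids (find (fun i => listed i == H) ids)) => /listedP[i iI HE].
have hasH : has (fun i => listed i == H) ids.
  by apply/hasP; exists i => //; apply/eqP/val_inj.
split; first by rewrite mem_nth // -has_find.
exact/eqP/(nth_find 1%positive hasH).
Qed.

Definition index_of (H : {group 'S_6}) : positive := sval (index_exists H).

Lemma index_ofP (H : {group 'S_6}) :
  H \subset A6 -> index_of H \in ids /\ listed (index_of H) = H.
Proof. exact: (svalP (index_exists H)). Qed.

Lemma index_ofK i : i \in ids -> index_of (listed i) = i.
Proof.
move=> iI; have [jI jE] := index_ofP (listed_sub_A6 iI).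
by apply: listed_inj; rewrite // jE.
Qed.

Definition ordinal_of (v : positive) : 'I_132 := @inord 131 (Pos.to_nat v).-1.

Lemma val_ordinal_of v : in_range 132 v -> ordinal_of v = (Pos.to_nat v).-1 :> nat.
Proof. by move/in_rangeP=> [k _ kE]; rewrite inordK // -kE; exact: ltn_ord. Qed.

Definition orbit_label (H K : {group 'S_6}) : 'I_132 :=
  ordinal_of (pair_label (index_of H) (index_of K)).

Lemma pair_label_range i j : i \in ids -> j \in ids -> listed i \subset listed j -> in_range 132 (pair_label i j).
Proof.
move=> iI jI ij; have [v v132 [gv _ _]] := le_id_get iI jI ij.
rewrite /pair_label gv /in_range (_ : 132 = Pos.to_nat 132) //.
exact/leP/Pos2Nat.inj_le/Pos.leb_le.
Qed.

Lemma val_orbit_label i j : i \in ids -> j \in ids -> listed i \subset listed j ->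
  orbit_label (listed i) (listed j) = (Pos.to_nat (pair_label i j)).-1 :> nat.
Proof.
by move=> iI jI ij; rewrite /orbit_label !index_ofK // val_ordinal_of // pair_label_range.
Qed.

Lemma value_pair_label (f : {ffun 'I_132 -> bool}) i j : i \in ids -> j \in ids -> listed i \subset listed j ->
  value f (pair_label i j) = f (orbit_label (listed i) (listed j)).
Proof.
move=> iI jI ij; rewrite /value; have [k -> kE] := in_rangeP (pair_label_range iI jI ij).
by congr (f _); apply: val_inj; rewrite /= kE val_orbit_label.
Qed.

Lemma orbit_label_conjg (H K : {group 'S_6}) x : H \subset K -> K \subset A6 -> x \in A6 ->
  orbit_label (H :^ x)%G (K :^ x)%G = orbit_label H K.
Proof.
move=> HK KA xA; have [iI iE] := index_ofP (subset_trans HK KA); have [jI jE] := index_ofP KA.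
have [i1 i1I i1E] := listed_conj xA iI; have [j1 j1I j1E] := listed_conj xA jI.
have <- : listed i1 = (H :^ x)%G by apply: val_inj; rewrite /= i1E iE.
have <- : listed j1 = (K :^ x)%G by apply: val_inj; rewrite /= j1E jE.
rewrite /orbit_label !index_ofK //; congr ordinal_of; rewrite /pair_label.
have -> : get orbits i1 j1 = get orbits (index_of H) (index_of K); last exact: erefl.
have mI : [/\ index_of H \in ids, index_of K \in ids, i1 \in ids & j1 \in ids] by split.
have ij : listed (index_of H) \subset listed (index_of K) by rewrite iE jE.
exact: (get_conj xA mI ij i1E j1E).
Qed.

Lemma orbit_label_inj (H K H1 K1 : {group 'S_6}) :
  H \subset K -> K \subset A6 -> H1 \subset K1 -> K1 \subset A6 ->
  orbit_label H K = orbit_label H1 K1 -> exists2 x, x \in A6 & H1 = (H :^ x)%G /\ K1 = (K :^ x)%G.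
Proof.
move=> HK KA HK1 KA1.
have [[iI iE] [jI jE]] := (index_ofP (subset_trans HK KA), index_ofP KA).
have [[i1I i1E] [j1I j1E]] := (index_ofP (subset_trans HK1 KA1), index_ofP KA1).
rewrite -iE -jE -i1E -j1E in HK HK1 *.
move/(congr1 val); rewrite /= !val_orbit_label // => /to_nat_inj.
have [v _ [gv _ _]] := le_id_get iI jI HK; have [v1 _ [gv1 _ _]] := le_id_get i1I j1I HK1.
rewrite /pair_label gv gv1 => ev; rewrite ev in gv.
have [_ _ [x xA [iEx jEx]]] := orbits_sound gv.
have [_ _ [y yA [i1Ey j1Ey]]] := orbits_sound gv1.
exists (x^-1 * y); first by rewrite groupM ?groupV.
by split; apply: val_inj; rewrite /= ?i1Ey ?j1Ey ?iEx ?jEx conjsgM conjsgK.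
Qed.

Lemma root_prop v : v \in labels ->
  [/\ (root v).1 \in ids, (root v).2 \in ids, listed (root v).1 \subset listed (root v).2
    & pair_label (root v).1 (root v).2 = v].
Proof.
move/(allP root_ids); case: (root v) => h k /and4P[hI kI].
by rewrite le_idP // /pair_label => hk /eqP->.
Qed.

Lemma orbit_label_surj (u : 'I_132) :
  exists H K : {group 'S_6}, [/\ H \subset K, K \subset A6 & orbit_label H K = u].
Proof.
pose v := Pos.of_succ_nat u.
have vE : Pos.to_nat v = u.+1 by rewrite SuccNat2Pos.id_succ.
have vL : v \in labels.
  by apply: labelsP; apply/Pos.leb_le/Pos2Nat.inj_le/leP; rewrite vE; exact: ltn_ord.
have [hI kI hk ov] := root_prop vL.
exists (listed (root v).1), (listed (root v).2); split=> //; first exact: listed_sub_A6.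
by apply: val_inj; rewrite /= val_orbit_label // ov vE.
Qed.

(** Each instance of an axiom is moved by conjugation to an instance whose main
pair is the root of its orbit, where it is one of the clauses. *)
Lemma sat_transfer_cnf (f : {ffun 'I_132 -> bool}) :
  sat f transfer_cnf <-> transfer_labels A6 orbit_label f.
Proof.
rewrite transfer_cnfE sat_flatten all_map.
have mem_ids (H : {group 'S_6}) : H \subset A6 -> exists2 i, i \in ids & H = listed i.
  by case/listedP=> i iI HE; exists i => //; apply: val_inj.
split=> [/allP satf|[refl_f trans_f restr_f]]; last first.
  apply/allP=> v /root_prop; case E: (root v) => [h k] /= [hI kI hk ov].
  apply/(sat_clauses_at f E); split.
  - by move=> ehk; rewrite -ov value_pair_label // ehk; apply: refl_f; exact: listed_sub_A6.
  - move=> l; rewrite mem_lower // => /andP[lI lk]; rewrite -{1}ov value_pair_label // => fhk.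
    have [cI cE] := meetP hI lI; rewrite value_pair_label ?cE ?subsetIr //.
    have -> : listed (first_below (lower h) (row_of l)) = (listed h :&: listed l)%G by apply: val_inj.
    by apply: restr_f fhk => //; exact: listed_sub_A6.
  move=> l; rewrite mem_lower // => /andP[lI lh]; rewrite value_pair_label // -ov value_pair_label //.
  rewrite value_pair_label // ?(subset_trans lh) //; apply: trans_f => //; exact: listed_sub_A6.
have sat_root i j : i \in ids -> j \in ids -> listed i \subset listed j -> exists h k x,
   [/\ h \in ids, k \in ids, listed h \subset listed k & x^-1 \in A6]
   /\ [/\ listed i :^ x^-1 = listed h, listed j :^ x^-1 = listed k, h = k -> value f (pair_label i j),
         {in lower k, forall l, value f (pair_label i j) ->
            value f (pair_label (first_below (lower h) (row_of l)) l)}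
       & {in lower h, forall l, value f (pair_label l h) -> value f (pair_label i j) ->
            value f (pair_label l k)}].
  move=> iI jI ij; have [v v132 [gv _ _]] := le_id_get iI jI ij.
  have -> : pair_label i j = v by rewrite /pair_label gv.
  have vL := labelsP v132; have := root_prop vL; have := satf v vL.
  have [_ _ [x xA []]] := orbits_sound gv.
  case E: (root v) => [h k] /= iE jE /(sat_clauses_at f E)[C1 C2 C3] [hI kI hk _].
  by exists h, k, x; rewrite groupV iE jE !conjsgK.
have conj_listed (H : {group 'S_6}) x k : k \in ids -> H :^ x \subset listed k ->
    exists2 l, l \in lower k & (H :^ x)%G = listed l.
  move=> kI Hk; have [|l lI lE] := mem_ids (H :^ x)%G.
    exact: subset_trans Hk (listed_sub_A6 kI).
  by exists l; rewrite // mem_lower // lI -lE.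
split.
- move=> K /mem_ids[i iI ->]; rewrite -value_pair_label //.
  have [h [k [x [[hI kI _ _] [hE kE C1 _ _]]]]] := sat_root i i iI iI (subxx _).
  by apply: C1; apply: listed_inj => //; rewrite -hE.
- move=> H K L HK KL LA; have KA := subset_trans KL LA; have HA := subset_trans HK KA.
  have [[j jI KE] [i iI LE]] := (mem_ids K KA, mem_ids L LA); subst K L.
  have [h [k [x [[hI kI hk xA] [hE kE _ _ C3]]]]] := sat_root j i jI iI KL.
  have [|l] := @conj_listed H x^-1 h hI; first by rewrite -hE conjSg.
  rewrite mem_lower // => /andP[lI lh] lE.
  have orbit_labelE q r : q \in ids -> r \in ids -> listed l \subset listed r -> H \subset listed q ->
      listed q :^ x^-1 = listed r -> orbit_label H (listed q) = orbit_label (listed l) (listed r).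
    move=> qI rI lr Hq qE; rewrite -(orbit_label_conjg Hq _ xA) ?listed_sub_A6 // lE.
    by congr orbit_label; apply: val_inj.
  rewrite (orbit_labelE j h) // (orbit_labelE i k) ?(subset_trans lh) ?(subset_trans HK) //.
  rewrite -!value_pair_label ?(subset_trans lh) // => fl fji; apply: C3 => //.
  by rewrite mem_lower // lI.
move=> H K L HK LK KA; have HA := subset_trans HK KA.
have [[i iI HE] [j jI KE]] := (mem_ids H HA, mem_ids K KA); subst H K.
have [h [k [x [[hI kI hk xA] [hE kE _ C2 _]]]]] := sat_root i j iI jI HK.
have [|l ll lE] := @conj_listed L x^-1 k kI; first by rewrite -kE conjSg.
have [lI lk] : l \in ids /\ listed l \subset listed k by apply/andP; rewrite -mem_lower.
rewrite -value_pair_label // => /(C2 l ll); have [mI mE] := meetP hI lI.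
rewrite value_pair_label ?mE ?subsetIr //.
have -> : orbit_label (listed i :&: L)%G L
          = orbit_label (listed (first_below (lower h) (row_of l))) (listed l); last by [].
rewrite -(orbit_label_conjg (subsetIr (listed i) L) (subset_trans LK KA) xA) lE.
by congr orbit_label; apply: val_inj; rewrite /= mE conjIg hE -lE.
Qed.

Lemma count_models_exact n k F m : count_models k F = Some (m, n) -> bounded n F -> nsat n F = m.
Proof.
move=> cF /(count_modelsP cF); rewrite /counts => /eqP.
by rewrite eqn_pmul2r ?expn_gt0 // => /eqP.
Qed.

Lemma transfer_cnf_range : all (fun x => Pos.leb x 132) (vars transfer_cnf).
Proof. by vm_compute. Qed.

(** Every recursive call has fewer variables than its caller, so the depth of the
recursion is at most 133. *)
Lemma count_transfer_cnf : count_models 400 transfer_cnf = Some (37799146070%num, 132).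
Proof. by vm_compute. Qed.

Lemma bounded_transfer_cnf : bounded 132 transfer_cnf.
Proof.
move=> x /(allP transfer_cnf_range)/Pos.leb_le/Pos2Nat.inj_le/leP.
exact.
Qed.

Theorem theorem2 : #|transfer_systems ('Alt_('I_6))%G| = nat_of_bin 37799146070%num.
Proof.
rewrite -A6E -(count_models_exact count_transfer_cnf bounded_transfer_cnf).
apply: (card_transfer_systems orbit_label_conjg orbit_label_inj orbit_label_surj) => f.
by rewrite inE; exact: sat_transfer_cnf.
Qed.
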